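(* Let $n\ge1$ and let $K,L\subset\mathbb{R}^n$ be compact convex sets containing the origin with $\dim K=\dim L=n$. Then the following implications hold. (1) Let $n\ge 2$ and $k\in\{1,\dots,n-1\}$, and let $H_0=\mathrm{lin}\{\mathrm{e}_1,\dots,\mathrm{e}_k\}$. If for every non-empty convex bounded set $M\subset\mathbb{R}^n$ the inequality \[ \mathrm{G}_{n-k}(P_{H_0^\perp} M)\,\mathrm{G}_{k}(M\cap H_0)\leq\binom{n}{k}\,\mathrm{G}_{n}\bigl(M+(-1,1)^n\bigr) \] holds, then for every $k$-dimensional linear subspace $H\subset\mathbb{R}^n$, \[ \mathrm{vol}_{n-k}(P_{H^\perp} K)\,\mathrm{vol}_k(K\cap H)\leq\binom{n}{k}\,\mathrm{vol}_n(K). \] (2) If for all convex bounded sets $M,N\subset\mathbb{R}^n$ containing the origin the inequality \[ \mathrm{G}_{n}(M+N)\,\mathrm{G}_{n}\bigl(M\cap(-N)\bigr)\leq \binom{2n}{n}\,\mathrm{G}_{n}\bigl(M+(-1,1)^n\bigr)\, \mathrm{G}_{n}\bigl(N+(-2,2)^n\bigr) \] holds, then \[ \mathrm{vol}_n(K+L)\,\mathrm{vol}_n\bigl(K\cap(-L)\bigr)\leq\binom{2n}{n}\,\mathrm{vol}_n(K)\,\mathrm{vol}_n(L). \]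
   Context: $\mathrm{e}_i$ is the $i$-th canonical unit vector, $\mathrm{lin}$ denotes linear hull, $P_E$ is orthogonal projection onto a linear subspace $E$, $E^\perp$ is the orthogonal complement, and $\dim$ of a set is the dimension of its affine hull. $\mathrm{vol}_j$ is $j$-dimensional Lebesgue measure (on $j$-dimensional subspaces where relevant). For $M\subset\mathbb{R}^n$, $\mathrm{G}_n(M)=|M\cap\mathbb{Z}^n|$; for $M\subset H_0$, $\mathrm{G}_k(M)=|M\cap(\mathbb{Z}^k\times\{0_{n-k}\})|$; for $M\subset H_0^\perp$, $\mathrm{G}_{n-k}(M)=|M\cap(\{0_k\}\times\mathbb{Z}^{n-k})|$. Sums of sets are Minkowski sums. The theorem asserts that the discrete inequalities imply their continuous counterparts. *)

(* Defs.v *)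
From HB Require Import structures.
From mathcomp Require Import all_boot all_order all_algebra.
From mathcomp Require Import finmap.
From mathcomp Require Import all_classical all_reals all_analysis.

Set Implicit Arguments.
Unset Strict Implicit.
Unset Printing Implicit Defensive.

Import Order.TTheory GRing.Theory Num.Theory.
Import numFieldNormedType.Exports.

Local Open Scope classical_set_scope.
Local Open Scope ring_scope.

(* The product measure m1 \x m2 under a fresh head constant: for m1 \x m2
   itself, canonical structure inference only finds the sigma-finiteness of
   products of subprobabilities. *)
Section SigmaFiniteProduct.
Context d1 d2 (T1 : measurableType d1) (T2 : measurableType d2) (R : realType).
Variables (m1 : {sigma_finite_measure set T1 -> \bar R})
          (m2 : {sigma_finite_measure set T2 -> \bar R}).

Definition sfprod : set (T1 * T2) -> \bar R := (m1 \x m2)%E.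

HB.instance Definition _ := Measure.copy sfprod (m1 \x m2)%E.

Let sfprod_sigma_finite : sigma_finite [set: T1 * T2] sfprod.
Proof.
have /sigma_finiteP[F [TF ndF Foo]] := sigma_finiteT m1.
have /sigma_finiteP[G [TG ndG Goo]] := sigma_finiteT m2.
exists (fun n => F n `*` G n).
  rewrite -setXTT TF TG predeqE => -[x y]; split.
    move=> [/= [n _ Fnx] [k _ Gky]]; exists (maxn n k) => //; split.
    - by move: x Fnx; exact/subsetPset/ndF/leq_maxl.
    - by move: y Gky; exact/subsetPset/ndG/leq_maxr.
  by move=> [n _ []/= ? ?]; split; exists n.
move=> k; have [? ?] := Foo k; have [? ?] := Goo k.
split; first exact: measurableX.
by rewrite /sfprod product_measure1E// lte_mul_pinfty// ge0_fin_numE.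
Qed.

HB.instance Definition _ := Measure_isSigmaFinite.Build _ _ _ sfprod
  sfprod_sigma_finite.

End SigmaFiniteProduct.

Record sfin_space (R : realType) := SFinSpace {
  sfs_display : measure_display;
  sfs_carrier : measurableType sfs_display;
  sfs_measure : {sigma_finite_measure set sfs_carrier -> \bar R} }.

(* R * (R * ( ... * unit)), with the n-fold product of the Lebesgue measure
   of R; the unit factor carries the Dirac mass. *)
Fixpoint lebesgue_space (R : realType) (n : nat) : sfin_space R :=
  if n is m.+1 then
    SFinSpace (sfprod (@lebesgue_measure R) (sfs_measure (lebesgue_space R m)))
  else SFinSpace (@dirac _ unit tt R).

Fixpoint rV_of_lebesgue_space (R : realType) (n : nat) :
    sfs_carrier (lebesgue_space R n) -> 'rV[R]_n :=
  if n is m.+1 return sfs_carrier (lebesgue_space R n) -> 'rV[R]_n then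
    fun p => row_mx p.1%:M (rV_of_lebesgue_space p.2) : 'rV[R]_(1 + m)
  else fun=> 0.

(* The underlying set function is total; it is the Lebesgue measure on the
   Borel sets, in particular on all compact sets. *)
Definition vol (R : realType) (n : nat) (A : set 'rV[R]_n) : \bar R :=
  sfs_measure (lebesgue_space R n) (@rV_of_lebesgue_space R n @^-1` A).

Section Euclidean.
Variables (R : realType) (n : nat).
Implicit Types (x y : 'rV[R]_n) (A B E M : set 'rV[R]_n).

Definition dotrV x y : R := \sum_(i < n) x 0 i * y 0 i.

Definition orth E : set 'rV[R]_n :=
  [set x | forall y, E y -> dotrV x y = 0].

Definition oproj E M : set 'rV[R]_n :=
  [set y | E y /\ exists2 x, M x & orth E (x - y)].

Definition orthonormal_basis (j : nat) E (B : 'M[R]_(j, n)) : Prop :=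
  (forall i i', dotrV (row i B) (row i' B) = (i == i')%:R) /\
  E = [set x | (x <= B)%MS].

(* j-dimensional Lebesgue measure on a j-dimensional linear subspace E, read
   in the coordinates of some orthonormal basis of E; by rotation invariance
   the choice of the basis is irrelevant. *)
Definition vol_on (j : nat) E A : \bar R :=
  let B := get [set B : 'M[R]_(j, n) | orthonormal_basis E B] in
  vol [set c : 'rV[R]_j | A (c *m B)].

Definition affine_hull A : set 'rV[R]_n :=
  [set x | exists (m : nat) (a : 'I_m -> 'rV[R]_n) (c : 'I_m -> R),
    [/\ forall i, A (a i), \sum_(i < m) c i = 1 & x = \sum_(i < m) c i *: a i]].

Definition has_dim A (d : nat) : Prop :=
  exists (p : 'rV[R]_n) (V : {vspace 'rV[R]_n}),
    affine_hull A = [set p + v | v in [set` V]] /\ \dim V = d.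

Definition minkowski_sum A B : set 'rV[R]_n := [set x + y | x in A & y in B].

Definition oppset A : set 'rV[R]_n := [set - x | x in A].

Definition open_cube (r : R) : set 'rV[R]_n :=
  [set x | forall i, - r < x 0 i < r].

Definition integer_points : set 'rV[R]_n :=
  [set x | forall i, x 0 i \is a Num.int].

(* The lattices Z^k x {0} and {0} x Z^(n-k). *)
Definition integer_points_first (k : nat) : set 'rV[R]_n :=
  [set x | integer_points x /\ forall i : 'I_n, (k <= i)%N -> x 0 i = 0].

Definition integer_points_last (k : nat) : set 'rV[R]_n :=
  [set x | integer_points x /\ forall i : 'I_n, (i < k)%N -> x 0 i = 0].

(* Cardinalities of finite sets: fset_set of an infinite set is empty, so these
   are only meaningful on bounded sets. *)
Definition G_n M : nat := #|` fset_set (M `&` integer_points)|.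
Definition G_first (k : nat) M : nat :=
  #|` fset_set (M `&` integer_points_first k)|.
Definition G_last (k : nat) M : nat :=
  #|` fset_set (M `&` integer_points_last k)|.

Definition coord_subspace (k : nat) : {vspace 'rV[R]_n} :=
  <<[seq (delta_mx 0 i)%R | i : 'I_n <- enum 'I_n & (i < k)%N]>>%VS.

End Euclidean.
Arguments open_cube {R} n r.
Arguments coord_subspace R n k : clear implicits.

(* Main.v *)
Require Import Defs.
From HB Require Import structures.
From mathcomp Require Import all_boot all_order all_algebra.
From mathcomp Require Import finmap.
From mathcomp Require Import all_classical all_reals all_analysis.
From mathcomp Require Import measurable_realfun.
From mathcomp Require Import ring lra.

(* A convex body A containing a box p + [-rho, rho]^n satisfies
   (m - C)^n vol A <= #(mA \cap Z^n) and
   #((mA + (-s,s)^n) \cap Z^n) <= (m + C)^n vol A: attach to each lattice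
   point z the cube z + [0,1)^n, and note that thickening mA by a cube of side
   s stays inside a homothetic copy of A of ratio m + O(s/rho).  The discrete
   inequalities for mK and mL, divided by the appropriate power of m, then give
   the continuous ones.  A degenerate section K \cap H or K \cap (-L) has volume
   zero, so the lower bound is trivial for it.

   For an arbitrary subspace H one rotates to H_0.  Rotation invariance of the
   volume comes from the same count: for a translation-invariant measure mu,
   homogeneous of degree n, it gives mu A = mu([0,1)^n) vol A, and for
   mu = vol o O^-1 with O orthogonal the constant is 1, as the unit ball
   shows. *)

Set Implicit Arguments.
Unset Strict Implicit.
Unset Printing Implicit Defensive.

Import Order.TTheory GRing.Theory Num.Theory.
Import numFieldNormedType.Exports.

Local Open Scope classical_set_scope.
Local Open Scope ring_scope.

(** * The volume on row vectors *)

(** The discrete inequality is only applied to dilates mK, mL, and both sides then grow with the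
    same power of m: exponent k + (n - k) in (1), n + n in (2). Errors of bounded size in the ratio
    m therefore cancel in the comparison, whatever their constants. The estimates are one-sided:
    sections, projections, sums and intersections stand on the smaller side, where a lower count
    suffices; K and L stand thickened on the larger side, and they contain a box. [vol] is an
    iterated product along the coordinate axes, so nothing about rotations is built into it, while
    [vol_on] reads volumes in an arbitrary orthonormal basis. The counting lemmas are therefore
    stated for [vol_mx O], the volume pulled back along an invertible matrix: [O = 1] serves the
    inequalities, a general [O] serves rotation invariance, and no determinant is computed. *)

Definition scaled_pushforward d1 d2 (T1 : measurableType d1)
    (T2 : measurableType d2) (R : realType) (m : {measure set T1 -> \bar R})
    (r : {nonneg R}) (f : T1 -> T2) (mf : measurable_fun setT f) :
  {measure set T2 -> \bar R}.
Proof. refine (mscale r (pushforward m f)); exact: mf. Defined.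

Section Volume.
Variable R : realType.

Local Notation space n := (sfs_carrier (lebesgue_space R n)).
Local Notation toV := (@rV_of_lebesgue_space R _).

Fixpoint lebesgue_space_of_rV (n : nat) : 'rV[R]_n -> space n :=
  if n is m.+1 return 'rV[R]_n -> space n then
    fun x : 'rV[R]_(1 + m) =>
      (x 0 0 : measurableTypeR R, lebesgue_space_of_rV (rsubmx x))
  else fun=> tt.

Lemma lebesgue_space_of_rVK n :
  cancel (@lebesgue_space_of_rV n) (@rV_of_lebesgue_space R n).
Proof.
elim: n => [x|n IH x /=]; first by rewrite thinmx0 [RHS]thinmx0.
rewrite IH -[RHS](@hsubmxK _ 1 1 n x).
suff -> : (x 0 0)%:M = @lsubmx _ 1 1 n x by [].
by apply/rowP => i; rewrite !mxE ord1 mulr1n; congr (x _ _); apply/val_inj.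
Qed.

Lemma rV_of_lebesgue_spaceS n (p : space n.+1) (i : 'I_n.+1) :
  toV p 0 i = if unlift ord0 i is Some j then toV p.2 0 j else p.1.
Proof.
case: unliftP => [j ->|->].
  have -> : lift ord0 j = @rshift 1 n j by apply: val_inj.
  exact: (row_mxEr p.1%:M (toV p.2)).
have -> : ord0 = @lshift 1 n 0 by apply: val_inj.
by rewrite [LHS](row_mxEl p.1%:M (toV p.2)) mxE.
Qed.

Lemma measurable_coord n (i : 'I_n) :
  measurable_fun [set: space n] (fun t => toV t 0 i).
Proof.
elim: n i => [[]//|n IH i].
under eq_fun do rewrite rV_of_lebesgue_spaceS.
case: (unlift ord0 i) => [j|]; last exact: measurable_fst.
exact: (measurableT_comp (IH j) measurable_snd).
Qed.

(** Nested pairs carry the product sigma-algebra, so measurability is tested one factor at a time,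
    by induction on the dimension. *)
Lemma measurable_lebesgue_space d (T : measurableType d) n (f : T -> space n) :
  (forall i, measurable_fun setT (fun t => toV (f t) 0 i)) ->
  measurable_fun setT f.
Proof.
elim: n f => [|n IH] f mf.
  by rewrite (_ : f = cst tt)//; apply/funext => t; case: (f t).
apply/measurable_fun_pairP; split.
  have := mf ord0; congr (measurable_fun _ _); apply/funext => t.
  by rewrite rV_of_lebesgue_spaceS unlift_none.
apply: IH => i; have := mf (lift ord0 i).
by congr (measurable_fun _ _); apply/funext => t;
  rewrite rV_of_lebesgue_spaceS liftK.
Qed.

(** [vol] is total, but monotonicity, additivity and scaling are proved only for these sets, whose
    nested-pair form is measurable. *)
Definition borel_rV n (A : set 'rV[R]_n) := measurable (toV @^-1` A : set
  (space n)).

Definition borel_map n m (g : 'rV[R]_n -> 'rV[R]_m) :=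
  forall i, measurable_fun [set: space n] (fun t => g (toV t) 0 i).

(** The map [g] conjugated to the nested product spaces, where pushforward measures can be
    formed. *)
Definition transport n m (g : 'rV[R]_n -> 'rV[R]_m) (t : space n) : space m :=
  lebesgue_space_of_rV (g (toV t)).

Lemma measurable_transport n m (g : 'rV[R]_n -> 'rV[R]_m) :
  borel_map g -> measurable_fun setT (transport g).
Proof.
move=> mg; apply: measurable_lebesgue_space => i.
rewrite /transport; under eq_fun do rewrite lebesgue_space_of_rVK.
exact: mg.
Qed.

Lemma borel_preimage n m (g : 'rV[R]_n -> 'rV[R]_m) A :
  borel_map g -> borel_rV A -> borel_rV (g @^-1` A).
Proof.
move=> /measurable_transport mg mA; have := mg measurableT _ mA.
rewrite setTI /borel_rV; congr measurable; apply/seteqP.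
by split=> t /=; rewrite /transport lebesgue_space_of_rVK.
Qed.

Lemma borel_map_affine n m (t : R) (O : 'M[R]_(n, m)) (a : 'rV[R]_m) :
  borel_map (fun x => t *: (x *m O) + a).
Proof.
move=> i; under eq_fun do rewrite !mxE.
apply: measurable_funD => //; apply: measurable_funM => //.
apply: measurable_sum => j; apply: measurable_funM => //.
exact: measurable_coord.
Qed.

Lemma borel_mulmx n m (O : 'M[R]_(n, m)) A :
  borel_rV A -> borel_rV [set x | A (x *m O)].
Proof.
move=> /(borel_preimage (borel_map_affine 1 O 0)); congr borel_rV.
by apply/funext => x; rewrite /preimage /= scale1r addr0.
Qed.

Lemma borel_map_scale_shift n (t : R) (a : 'rV[R]_n) :
  borel_map (fun x => t *: x + a).
Proof.
move=> i; under eq_fun do rewrite -[toV _]mulmx1.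
exact: borel_map_affine.
Qed.

Lemma borel_affine n (t : R) (a : 'rV[R]_n) A :
  borel_rV A -> borel_rV [set x | A (t *: x + a)].
Proof. exact/borel_preimage/borel_map_scale_shift. Qed.

Lemma borel_countable_bigcup n (T : countType) (P : set T) (F : T -> set
  'rV[R]_n) :
  (forall k, borel_rV (F k)) -> borel_rV (\bigcup_(k in P) F k).
Proof.
move=> mF; rewrite /borel_rV preimage_bigcup.
rewrite bigcup_mkcond; apply: countable_bigcupT_measurable => [|k];
  first exact: countableP.
by case: ifP => _; [exact: mF|exact: measurable0].
Qed.

Lemma borel_bigcap n (F : nat -> set 'rV[R]_n) :
  (forall k, borel_rV (F k)) -> borel_rV (\bigcap_k F k).
Proof. by move=> mF; rewrite /borel_rV preimage_bigcap;
  exact: bigcapT_measurable. Qed.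

(* Half-open, so that the integer translates tile the space. *)
Definition unit_cube n : set 'rV[R]_n := [set x | forall i, 0 <= x 0 i < 1].

Lemma unit_cubeS n : toV @^-1` (@unit_cube n.+1) =
  ([set` `[0, 1[] : set (measurableTypeR R)) `*` (toV @^-1` (@unit_cube n)).
Proof.
apply/seteqP; split=> p.
  move=> h; split => [|i]; rewrite /= ?in_itv /=.
    have := h ord0; rewrite rV_of_lebesgue_spaceS unlift_none.
    by [].
  have := h (lift ord0 i); rewrite rV_of_lebesgue_spaceS liftK.
  by [].
move=> [/=]; rewrite in_itv /= => ha ht i.
by rewrite rV_of_lebesgue_spaceS; case: unliftP.
Qed.

Lemma unit_cube0 : toV @^-1` (@unit_cube 0) = setT.
Proof. by apply/seteqP; split=> // t _ []. Qed.

Lemma borel_unit_cube n : borel_rV (@unit_cube n).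
Proof.
elim: n => [|n IH]; first by rewrite /borel_rV unit_cube0.
rewrite /borel_rV unit_cubeS; exact: measurableX.
Qed.

Lemma vol_unit_cube n : vol (@unit_cube n) = 1%E.
Proof.
elim: n => [|n IH]; first by rewrite /vol unit_cube0 /= diracT.
rewrite /vol unit_cubeS /= /sfprod product_measure1E//;
  last exact: borel_unit_cube.
move: IH; rewrite /vol => ->; rewrite mule1.
by have := @lebesgue_measure_itv R `[0, 1[; rewrite /= lte_fin ltr01 sube0.
Qed.

Lemma vol_ge0 n (A : set 'rV[R]_n) : (0 <= vol A)%E.
Proof. exact: measure_ge0. Qed.

Lemma le_vol n (A B : set 'rV[R]_n) :
  borel_rV A -> borel_rV B -> A `<=` B -> (vol A <= vol B)%E.
Proof. by move=> mA mB AB; apply: le_measure; rewrite ?inE//;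
  exact: preimage_subset. Qed.

Lemma vol_fin_bigcup n (I : choiceType) (D : set I) (F : I -> set 'rV[R]_n) :
  finite_set D -> trivIset D F -> (forall i, D i -> borel_rV (F i)) ->
  vol (\bigcup_(i in D) F i) = (\sum_(i \in D) vol (F i))%E.
Proof.
move=> Dfin Ftriv mF; rewrite /vol preimage_bigcup measure_fin_bigcup//.
by move=> i j Di Dj [t [Ft1 Ft2]]; apply: Ftriv => //; exists (toV t).
Qed.

(** The left side, as a function of [A], is a measure giving each interval ]b, c] its length, hence
    is Lebesgue measure by uniqueness. [scaled_pushforward] packages it as a measure for that
    theorem. *)
Lemma lebesgue_measure_affine (t a : R) (A : set (measurableTypeR R)) :
  0 < t -> measurable A ->
  (t%:E * lebesgue_measure ((fun x : measurableTypeR R => (t * x + a)%R :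
    measurableTypeR R) @^-1` A) = lebesgue_measure A)%E.
Proof.
move=> t0 mA.
pose f := fun x : measurableTypeR R => (t * x + a)%R : measurableTypeR R.
have mf : measurable_fun setT f.
  by apply: measurable_funD => //; apply: measurable_funM.
pose m := scaled_pushforward (@lebesgue_measure R) (NngNum (ltW t0)) mf.
rewrite -[LHS]/(m A); apply/esym/lebesgue_measure_unique => // _ [[b c]] _ <-.
rewrite -[RHS]/(t%:E * lebesgue_measure (f @^-1` `]b, c]%classic))%E.
have -> : f @^-1` `]b, c]%classic = `](b - a) / t, (c - a) / t]%classic.
  apply/seteqP; split=> x /=; rewrite !in_itv /= /f.
    by rewrite ltr_pdivrMr// ler_pdivlMr// ltrBlDr lerBrDr mulrC.
  by rewrite ltr_pdivrMr// ler_pdivlMr// ltrBlDr lerBrDr mulrC.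
rewrite !lebesgue_measure_itv/= !lte_fin ltr_pM2r ?invr_gt0// ltrD2r.
case: ifP => _; last by rewrite mule0.
rewrite -!EFinB -EFinM; congr (_%:E).
by field; rewrite gt_eqF.
Qed.

Lemma transport_affineS n (t : R) (a : 'rV[R]_n.+1) (p : space n.+1) :
  transport (fun x => t *: x + a) p =
  ((t * p.1 + a 0 0 : measurableTypeR R),
    transport (fun x => t *: x + @rsubmx _ 1 1 n a) p.2).
Proof.
have e : toV p 0 ord0 = p.1 by rewrite rV_of_lebesgue_spaceS unlift_none.
apply: injective_projections;
  first by rewrite -e -[LHS]/((t *: toV p + a) 0 0) !mxE; congr (_ * _ + _).
congr lebesgue_space_of_rV; rewrite linearD linearZ /=.
by rewrite row_mxKr.
Qed.

(** By uniqueness of product measures only rectangles matter; the affine map acts on each factor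
    separately, and t^(n+1) splits as t times t^n. *)
Lemma lebesgue_space_affine n (t : R) (a : 'rV[R]_n) (X : set (space n)) :
  0 < t -> measurable X ->
  ((t ^+ n)%:E * sfs_measure (lebesgue_space R n)
     (transport (fun x => (t *: x + a)%R) @^-1` X) =
   sfs_measure (lebesgue_space R n) X)%E.
Proof.
move=> t0; elim: n a X => [|n IH] a X mX.
  rewrite expr0 mul1e; congr (sfs_measure _ _).
  by apply/funext => x; rewrite /preimage /=; case: (transport _ _); case: x.
have mf : measurable_fun setT (transport (fun x => t *: x + a)).
  exact/measurable_transport/borel_map_scale_shift.
have tn0 : 0 <= t ^+ n.+1 by rewrite exprn_ge0 ?ltW.
pose m := scaled_pushforward (sfs_measure (lebesgue_space R n.+1)) (NngNum tn0)
  mf.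
rewrite -[LHS]/(m X); apply/esym.
apply: product_measure_unique => // A B mA mB.
rewrite -[LHS]/((t ^+ n.+1)%:E * sfs_measure (lebesgue_space R n.+1) (transport
  (fun x => (t *: x + a)%R) @^-1` (A `*` B)))%E.
pose f := fun x : measurableTypeR R => (t * x + a 0 0)%R : measurableTypeR R.
pose g := transport (fun x => t *: x + @rsubmx _ 1 1 n a).
have -> : transport (fun x => t *: x + a) @^-1` (A `*` B) = (f @^-1` A) `*` (g
  @^-1` B).
  apply/funext => p.
  by rewrite -[LHS]/((A `*` B) (transport (fun x => t *: x + a) p))
    transport_affineS.
have mf1 : measurable_fun setT f.
  by apply: measurable_funD => //; apply: measurable_funM.
have mg : measurable_fun setT g.
  exact/measurable_transport/borel_map_scale_shift.
rewrite /= /sfprod product_measure1E//; last 2 first.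
- by rewrite -[X in measurable X]setTI; exact: mf1.
- by rewrite -[X in measurable X]setTI; exact: mg.
rewrite -(IH (@rsubmx _ 1 1 n a) B)// -(lebesgue_measure_affine (a 0 0) t0 mA).
by rewrite exprS EFinM muleACA.
Qed.

Lemma vol_affine n (t : R) (a : 'rV[R]_n) A : 0 < t -> borel_rV A ->
  ((t ^+ n)%:E * vol [set x | A (t *: x + a)%R] = vol A)%E.
Proof.
move=> t0 mA; rewrite /vol -(lebesgue_space_affine a t0 mA).
congr (_ * sfs_measure _ _)%E; apply/funext => x; rewrite /preimage/=.
by rewrite /transport lebesgue_space_of_rVK.
Qed.

End Volume.

(** * Lattice points and cubes *)

Section LatticePoints.
Variable R : realType.
Implicit Types n : nat.

Definition floor_rV n (x : 'rV[R]_n) : 'rV[int]_n := \row_i Num.floor (x 0 i).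

Definition int_rV n (z : 'rV[int]_n) : 'rV[R]_n := \row_i (z 0 i)%:~R.

Lemma integer_points_int_rV n (z : 'rV[int]_n) : integer_points (int_rV z).
Proof. by move=> i; rewrite mxE intr_int. Qed.

Lemma unit_cube_floor n (x : 'rV[R]_n) : unit_cube (x - int_rV (floor_rV x)).
Proof.
move=> i; rewrite !mxE subr_ge0 ltrBlDl.
by rewrite floor_le_tmp/= -(intrD _ _ 1) floorD1_gt.
Qed.

Lemma unit_cube_int_inj n (x z w : 'rV[R]_n) :
  integer_points z -> integer_points w ->
  unit_cube (x - z) -> unit_cube (x - w) -> z = w.
Proof.
move=> iz iw xz xw; apply/rowP => i.
have := xz i; have := xw i; rewrite !mxE.
have /intrP[a ->] := iz i; have /intrP[b ->] := iw i => hb ha.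
have fE (c : int) : 0 <= x 0 i - c%:~R < 1 -> Num.floor (x 0 i) = c.
  move=> /andP[h1 h2]; apply: floor_def.
  by rewrite -subr_ge0 h1 intrD -ltrBlDl h2.
by rewrite -(fE _ ha) -(fE _ hb).
Qed.

(** A closed set is the intersection over k of the unions of those grid cubes of side 1/(k+1) that
    meet it: a point of all these unions has points of [A] in its own grid cube at every scale, so
    it is adherent to [A]. *)
Lemma closed_borel n (A : set 'rV[R]_n) : closed A -> borel_rV A.
Proof.
move=> cA.
pose C k (z : 'rV[int]_n) := [set x : 'rV[R]_n | unit_cube (k.+1%:R *: x + (-
  int_rV z))].
pose P k := [set z | A `&` C k z !=set0].
have -> : A = \bigcap_k \bigcup_(z in P k) C k z.
  apply/seteqP; split=> x.
    move=> Ax k _; exists (floor_rV (k.+1%:R *: x));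
      last exact: unit_cube_floor.
    by exists x; split=> //; exact: unit_cube_floor.
  move=> h; apply: cA => B /nbhs_ballP[e /= e0 eB].
  have [k ke] : exists k : nat, k.+1%:R^-1 < e.
    exists (Num.truncn e^-1); rewrite invf_plt ?posrE//.
    exact: truncnS_gt.
  have [z [y [Ay Cy]] Cx] := h k I.
  exists y; split=> //; apply: eB; split=> // i j; rewrite ord1 /ball /=.
  have := Cy j; have := Cx j; rewrite !mxE => /andP[x1 x2] /andP[y1 y2].
  apply: le_lt_trans ke; rewrite -(ler_pM2l (ltr0Sn R k)) divff ?pnatr_eq0//.
  rewrite -{1}[k.+1%:R]ger0_norm// -normrM mulrBr ler_norml.
  by apply/andP; split; lra.
apply: borel_bigcap => k; apply: borel_countable_bigcup => z.
exact/borel_affine/borel_unit_cube.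
Qed.

Definition coord_bounded n (A : set 'rV[R]_n) :=
  exists N : nat, forall x, A x -> forall i, `|x 0 i| <= N%:R.

Lemma bounded_coord_bounded n (A : set 'rV[R]_n) : bounded_set A ->
  coord_bounded A.
Proof.
move=> [M [_ AM]]; exists (Num.truncn M).+1 => x Ax i.
apply: le_trans (AM _ (truncnS_gt M) _ Ax).
by rewrite [leRHS]mx_normrE; exact: (le_bigmax _ _ (0, i)).
Qed.

Lemma finite_integer_points n (A : set 'rV[R]_n) :
  coord_bounded A -> finite_set (A `&` @integer_points R n).
Proof.
move=> [N AN].
(* An integer coordinate bounded by [N] is k - N with 0 <= k <= 2N, so the points come from a finite
   type. *)
pose f (u : 'rV['I_(N + N).+1]_n) : 'rV[R]_n := \row_i ((u 0 i)%:R - N%:R).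
apply: (@sub_finite_set _ _ (f @` setT)); last exact: finite_image.
move=> x [Ax ix].
have h i : exists k : 'I_(N + N).+1, x 0 i = k%:R - N%:R.
  have := AN _ Ax i; rewrite ler_norml => /andP[h1 h2].
  have /natrP[k kE] : x 0 i + N%:R \is a Num.nat.
    rewrite natrEint; apply/andP; split; last by lra.
    by rewrite rpredD ?natr_int//; exact: ix.
  have kN : (k < (N + N).+1)%N.
    by rewrite ltnS -(ler_nat R) -kE natrD lerD2r.
  by exists (Ordinal kN); rewrite /= -kE addrK.
exists (\row_i projT1 (cid (h i))) => //; apply/rowP => i.
by rewrite !mxE; case: cid.
Qed.

End LatticePoints.

(** * Volume after an invertible linear change of variables *)

Section LinearImage.
Variables (R : realType) (n : nat) (O : 'M[R]_n).
Hypothesis O_unit : O \in unitmx.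
Implicit Types A B : set 'rV[R]_n.

(* The volume of the preimage of [A] under the linear map [O]: this is
   |det O|^-1 vol A, but only its translation invariance and its homogeneity
   are needed. *)
Definition vol_mx A : \bar R := vol [set x | A (x *m O)].

Lemma vol_mx_ge0 A : (0 <= vol_mx A)%E. Proof. exact: vol_ge0. Qed.

Lemma le_vol_mx A B : borel_rV A -> borel_rV B -> A `<=` B -> (vol_mx A <=
  vol_mx B)%E.
Proof. by move=> mA mB AB; apply: le_vol => [||x];
  [exact: borel_mulmx..|exact: AB]. Qed.

Lemma vol_mx_affine (t : R) (a : 'rV[R]_n) A : 0 < t -> borel_rV A ->
  ((t ^+ n)%:E * vol_mx [set x | A (t *: x + a)%R] = vol_mx A)%E.
Proof.
move=> t0 mA; rewrite /vol_mx -(vol_affine (a *m invmx O) t0 (borel_mulmx O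
  mA)).
congr (_ * vol _)%E; apply/funext => x /=.
by rewrite mulmxDl -scalemxAl mulmxKV.
Qed.

Lemma vol_mx_shift (a : 'rV[R]_n) A : borel_rV A ->
  vol_mx [set x | A (x + a)] = vol_mx A.
Proof.
move=> mA; rewrite -(vol_mx_affine a ltr01 mA) expr1n mul1e.
by congr vol_mx; apply/funext => x /=; rewrite scale1r.
Qed.

Lemma vol_mx_fin_bigcup (I : choiceType) (D : set I) (F : I -> set 'rV[R]_n) :
  finite_set D -> trivIset D F -> (forall i, D i -> borel_rV (F i)) ->
  vol_mx (\bigcup_(i in D) F i) = (\sum_(i \in D) vol_mx (F i))%E.
Proof.
move=> Dfin Ftriv mF; rewrite -vol_fin_bigcup//.
- by move=> i j Di Dj [t [Ft1 Ft2]]; apply: Ftriv => //; exists (t *m O).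
- by move=> i Di; exact/borel_mulmx/mF.
Qed.

(** The point where counts become volumes: cubes attached to distinct integer points are disjoint
    because a point determines its lattice point by floors, and all are translates of one cube. *)
Lemma vol_mx_cubes (D : set 'rV[R]_n) : finite_set D -> D `<=` @integer_points
  R n ->
  vol_mx (\bigcup_(z in D) [set x | unit_cube (x - z)]) =
  ((#|` fset_set D|%:R)%:E * vol_mx (@unit_cube R n))%E.
Proof.
move=> Dfin Dint; rewrite vol_mx_fin_bigcup//.
- under eq_fsbigr do rewrite (vol_mx_shift _ (@borel_unit_cube R n)).
  rewrite fsbig_finite//= big_const_seq count_predT iter_addr_0.
  by rewrite mule_natl.
- move=> z w Dz Dw [x [/= xz xw]].
  by apply: unit_cube_int_inj xz xw; exact: Dint.
- move=> z _; have := borel_affine 1 (- z) (@borel_unit_cube R n).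
  by congr borel_rV; apply/funext => x /=; rewrite scale1r.
Qed.

Lemma coord_bounded_mulmx A : coord_bounded A -> coord_bounded [set x | A (x *m
  O)].
Proof.
move=> [N AN].
pose M := \sum_(i < n) \sum_(j < n) N%:R * `|invmx O j i|.
exists (Num.truncn M).+1 => x Ax i; apply: le_trans (ltW (truncnS_gt M)).
rewrite -[x](mulmxK O_unit) mxE.
apply: le_trans (ler_norm_sum _ _ _) _.
rewrite /M [leRHS](bigD1 i)//=; apply: ler_wpDr; last first.
  by apply: ler_sum => j _; rewrite normrM ler_wpM2r//; exact: AN.
by apply: sumr_ge0 => k _; apply: sumr_ge0 => j _; rewrite mulr_ge0.
Qed.

End LinearImage.

Lemma vol_mx1 (R : realType) n (A : set 'rV[R]_n) : vol_mx 1%:M A = vol A.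
Proof. by congr vol; apply/funext => x /=; rewrite mulmx1. Qed.

(** [A] itself may fail to be Borel, so a covering set is produced: the half-open cube [-N, N + 1)^n
    of side r = 2N + 1, whose volume is finite because its rescaling is the unit cube. *)
Lemma coord_bounded_sub_fin_vol (R : realType) n (A : set 'rV[R]_n) :
  coord_bounded A -> exists S, [/\ borel_rV S, vol S \is a fin_num & A `<=` S].
Proof.
move=> [N AN]; pose r : R := (N + N).+1%:R.
have r0 : 0 < r by rewrite ltr0Sn.
have h : 0 < r^-1 by rewrite invr_gt0.
exists [set x | unit_cube (r^-1 *: x + const_mx (N%:R / r))]; split.
- exact/borel_affine/borel_unit_cube.
- rewrite ge0_fin_numE ?vol_ge0//.
  have := vol_affine (const_mx (N%:R / r)) h (@borel_unit_cube R n).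
  rewrite ltNge leye_eq vol_unit_cube => e; apply/negP => /eqP eoo.
  by move: e; rewrite eoo gt0_muley ?lte_fin ?exprn_gt0.
- move=> x Ax i; rewrite !mxE; have := AN _ Ax i;
  rewrite ler_norml => /andP[h1 h2].
  rewrite mulrC -mulrDl divr_ge0 ?(ltW r0)//; last by lra.
  by rewrite ltr_pdivrMr// mul1r /r -natr1 natrD; lra.
Qed.

Lemma vol_fin_num (R : realType) n (A : set 'rV[R]_n) : borel_rV A ->
  coord_bounded A ->
  vol A \is a fin_num.
Proof.
move=> mA /coord_bounded_sub_fin_vol[S [mS fS AS]].
by rewrite ge0_fin_numE ?vol_ge0// (le_lt_trans (le_vol mA mS AS))//
  -ge0_fin_numE ?vol_ge0.
Qed.

Lemma vol_mx_fin_num (R : realType) n (O : 'M[R]_n) (A : set 'rV[R]_n) :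
  O \in unitmx -> borel_rV A -> coord_bounded A -> vol_mx O A \is a fin_num.
Proof.
by move=> uO mA bA; apply: vol_fin_num;
  [exact: borel_mulmx|exact: coord_bounded_mulmx].
Qed.

(** * Lattice point counts against volumes, with explicit constants *)

Section Counting.
Variable R : realType.

Definition convexR n (A : set 'rV[R]_n) :=
  forall x y t, A x -> A y -> 0 <= t -> t <= 1 -> A (t *: x + (1 - t) *: y).

Lemma convex_setP n (A : set 'rV[R]_n) : convex_set A <-> convexR A.
Proof.
split=> [cA x y t Ax Ay t0 t1|cA x y l /set_mem Ax /set_mem Ay].
  have t01 : 0 <= t <= 1 by rewrite t0.
  by have /set_mem := cA x y (Itv01 t0 t1) (mem_set Ax) (mem_set Ay).
by apply/mem_set; exact: cA.
Qed.

(** Written as a preimage, so that membership unfolds by computation and the scaling lemmas apply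
    directly; [dilateE] gives the image form. *)
Definition dilate n (m : R) (A : set 'rV[R]_n) : set 'rV[R]_n := [set x | A
  (m^-1 *: x)].

Lemma dilateE n (m : R) (A : set 'rV[R]_n) : m != 0 ->
  dilate m A = [set m *: x | x in A].
Proof.
move=> m0; apply/seteqP; split=> x /=.
  by move=> Ax; exists (m^-1 *: x) => //; rewrite scalerA divff// scale1r.
by move=> [y Ay <-]; rewrite /dilate /= scalerA mulVf// scale1r.
Qed.

Definition contains_box n (A : set 'rV[R]_n) (p : 'rV[R]_n) (rho : R) :=
  forall x : 'rV[R]_n, (forall i, `|x 0 i - p 0 i| <= rho) -> A x.

Lemma borel_fin_bigcup n (I : Type) (D : set I) (F : I -> set 'rV[R]_n) :
  finite_set D -> (forall i, D i -> borel_rV (F i)) -> borel_rV (\bigcup_(i in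
    D) F i).
Proof.
by move=> Dfin mF; rewrite /borel_rV preimage_bigcup;
  exact: fin_bigcup_measurable.
Qed.

Lemma borel_cubes n (D : set 'rV[R]_n) : finite_set D ->
  borel_rV (\bigcup_(z in D) [set x | unit_cube (x - z)]).
Proof.
move=> Dfin; apply: borel_fin_bigcup => // z _.
have := borel_affine 1 (- z) (@borel_unit_cube R n).
by congr borel_rV; apply/funext => x /=; rewrite scale1r.
Qed.

Lemma vol_mx_dilate n (O : 'M[R]_n) (t : R) (a : 'rV[R]_n) A :
  O \in unitmx -> 0 < t -> borel_rV A ->
  vol_mx O [set x | A (t^-1 *: x + a)] = ((t ^+ n)%:E * vol_mx O A)%E.
Proof.
move=> uO t0 mA; have t0' : 0 < t^-1 by rewrite invr_gt0.
rewrite -(vol_mx_affine uO a t0' mA) muleA -EFinM -exprMn divff ?gt_eqF//.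
by rewrite expr1n mul1e.
Qed.

Lemma coord_bounded_thicken n (A B : set 'rV[R]_n) (m s : R) :
  0 < m -> coord_bounded A ->
  (forall x, B x -> exists2 y, A (m^-1 *: y) & forall i, `|x 0 i - y 0 i| <= s)
    ->
  coord_bounded B.
Proof.
move=> m0 [N AN] BA; exists (Num.truncn (m * N%:R + s)).+1 => x Bx i.
apply: le_trans (ltW (truncnS_gt _)).
have [y Ay /(_ i) xy] := BA _ Bx.
have := AN _ Ay i; rewrite mxE normrM gtr0_norm ?invr_gt0//.
rewrite mulrC ler_pdivrMr// mulrC => yN.
rewrite -[x 0 i](subrK (y 0 i)) addrC.
by apply: le_trans (ler_normD _ _) _; apply: lerD.
Qed.

Lemma coord_bounded_dilate n (A : set 'rV[R]_n) (m : R) :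
  0 < m -> coord_bounded A -> coord_bounded (dilate m A).
Proof.
move=> m0 bA; apply: (coord_bounded_thicken (s := 0) m0 bA) => x Ax.
by exists x => // i; rewrite subrr normr0.
Qed.

Section Asymptotics.
Variables (n : nat) (O : 'M[R]_n) (A : set 'rV[R]_n) (p : 'rV[R]_n) (rho : R).
Hypotheses (O_unit : O \in unitmx) (A_borel : borel_rV A) (A_cvx : convexR A)
  (A_bdd : coord_bounded A) (rho0 : 0 < rho) (A_box : contains_box A p rho).

Let volA := fine (vol_mx O A).
Let volQ := fine (vol_mx O (@unit_cube R n)).

Let volAE : vol_mx O A = volA%:E.
Proof. by rewrite fineK// vol_mx_fin_num. Qed.

Let volQE : vol_mx O (@unit_cube R n) = volQ%:E.
Proof.
rewrite fineK// vol_mx_fin_num//; first exact: borel_unit_cube.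
exists 1%N => x hx i; have /andP[? ?] := hx i; by rewrite ger0_norm// ltW.
Qed.

(** With t = m - 1/rho, the shrunken copy t(A - p) + mp is covered by the cubes at the lattice
    points of mA: rounding a point of the copy down to [z] does not leave mA, because the room
    gained by shrinking absorbs the rounding. *)
Lemma count_lower (m : nat) : rho^-1 < m%:R ->
  (m%:R - rho^-1) ^+ n * volA <= (G_n (dilate m%:R A))%:R * volQ.
Proof.
move=> Cm; set C := rho^-1 in Cm *; set t := m%:R - C.
have C0 : 0 < C by rewrite invr_gt0.
have t0 : 0 < t by rewrite subr_gt0.
have m0 : 0 < m%:R :> R by exact: lt_trans Cm.
rewrite -lee_fin !EFinM -volAE -volQE.
rewrite -(vol_mx_dilate (p - (m%:R / t) *: p) O_unit t0 A_borel).
have fD := finite_integer_points (coord_bounded_dilate m0 A_bdd).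
rewrite -(vol_mx_cubes O_unit fD); last by move=> ? [].
apply: le_vol_mx; [exact: borel_affine|exact: borel_cubes|].
move=> x /= Ax; set z := int_rV R (floor_rV x).
have xz := unit_cube_floor x; rewrite -/z in xz.
exists z => //; split; last exact: integer_points_int_rV.
rewrite /dilate /=.
have Cm1 : 0 <= t / m%:R <= 1.
  by rewrite divr_ge0 ?(ltW t0)// ler_pdivrMr// mul1r /t gerBl ltW.
have /andP[h0 h1] := Cm1.
(* z/m is the convex combination of the point of [A] given by [Ax], with weight t/m, and of this
   one, with weight C/m; since C * rho = 1, the latter contributes exactly the rounding error. *)
have By : A (p - rho *: (x - z)).
  apply: A_box => i; rewrite !mxE addrAC subrr add0r normrN normrM gtr0_norm//.
  have := xz i; rewrite !mxE => /andP[? ?].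
  by rewrite -[leRHS]mulr1 ler_pM2l// ger0_norm// ltW.
have := A_cvx Ax By h0 h1; congr A; apply/rowP => i; rewrite !mxE /t.
have -> : rho = C^-1 by rewrite invrK.
field; rewrite !gt_eqF//.
Qed.

(** Dual to the lower count: the cubes at the lattice points of [B] lie in the enlarged copy t(A -
    p) + mp with t = m + C. The thickening costs [s] and the cube 1 in each coordinate, whence C =
    (s + 1)/rho. *)
Lemma count_upper (s : R) (B : set 'rV[R]_n) (m : nat) : 0 <= s -> (0 < m)%N ->
  (forall x, B x -> exists2 y, A (m%:R^-1 *: y) & forall i, `|x 0 i - y 0 i| <=
    s) ->
  (G_n B)%:R * volQ <= (m%:R + (s + 1) / rho) ^+ n * volA.
Proof.
move=> s0; rewrite -(ltr0n R) => m0 BA.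
set C := (s + 1) / rho; set t := m%:R + C.
have C0 : 0 < C by rewrite divr_gt0// ltr_wpDl.
have t0 : 0 < t by rewrite addr_gt0.
rewrite -lee_fin !EFinM -volAE -volQE.
rewrite -(vol_mx_dilate (p - (m%:R / t) *: p) O_unit t0 A_borel).
have fD := finite_integer_points (coord_bounded_thicken m0 A_bdd BA).
rewrite -(vol_mx_cubes O_unit fD); last by move=> ? [].
apply: le_vol_mx; [exact: borel_cubes|exact: borel_affine|].
move=> x [z [Bz _] /= xz].
have [y Ay zy] := BA _ Bz.
have h0 : 0 <= m%:R / t by rewrite divr_ge0 ?ltW.
have h1 : m%:R / t <= 1 by rewrite ler_pdivrMr// mul1r lerDl ltW.
(* The displacement x - y is at most s + 1 in each coordinate, so after division by [C] it fits in
   the box of radius rho. *)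
have By : A (p + C^-1 *: (x - y)).
  apply: A_box => i; rewrite !mxE addrAC subrr add0r normrM gtr0_norm
    ?invr_gt0//.
  rewrite /C invf_div -mulrA ger_pMr// ler_pdivrMl ?ltr_wpDl// mulr1.
  have := xz i; rewrite !mxE => /andP[? ?].
  rewrite (_ : x 0 i - y 0 i = (z 0 i - y 0 i) + (x 0 i - z 0 i)); last by ring.
  by apply: le_trans (ler_normD _ _) _; rewrite lerD// ger0_norm// ltW.
have := A_cvx Ay By h0 h1; congr A; apply/rowP => i; rewrite !mxE /t.
field; rewrite !gt_eqF//.
Qed.

End Asymptotics.

End Counting.

(** * Convex bodies *)

Section ConvexBodies.
Variable R : realType.

Lemma bernoulli_ler (x : R) N : 0 <= x <= 1 -> 1 - N%:R * x <= (1 - x) ^+ N.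
Proof.
move=> /andP[x0 x1]; elim: N => [|N IH]; first by rewrite mul0r subr0 expr0.
rewrite exprS; apply: le_trans (ler_wpM2l _ IH); last by rewrite subr_ge0.
rewrite -natr1; have : 0 <= N%:R * x * x by rewrite !mulr_ge0.
by lra.
Qed.

(** Dividing by (m + C)^N and applying Bernoulli to 1 - 2C/(m + C) leaves a - b <= 2NCa/(m + C),
    which fails for one explicit large m if b < a. No limit is taken. *)
Lemma polynomial_growth_le (a b C : R) N : 0 <= C -> 0 <= a ->
  (forall m : nat, C < m%:R -> (m%:R - C) ^+ N * a <= (m%:R + C) ^+ N * b) ->
  a <= b.
Proof.
move=> C0 a0 h; rewrite leNgt; apply/negP => ba.
have ab : 0 < a - b by rewrite subr_gt0.
(* The threshold: the inequality above would force m + C <= D. *)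
pose D := N%:R * (2 * C) * a / (a - b).
have D0 : 0 <= D by rewrite !mulr_ge0 ?invr_ge0 ?(ltW ab).
pose m := (Num.truncn (C + D)).+1.
have Dm : C + D < m%:R by exact: truncnS_gt.
have Cm : C < m%:R by apply: le_lt_trans Dm; rewrite lerDl.
have mC : 0 < m%:R + C by rewrite ltr_wpDr//; exact: le_lt_trans Cm.
have := h _ Cm; rewrite -ler_pdivrMl ?exprn_gt0// mulrA -exprVn -exprMn.
have -> : (m%:R + C)^-1 * (m%:R - C) = 1 - 2 * C / (m%:R + C).
  by field; rewrite gt_eqF.
have x01 : 0 <= 2 * C / (m%:R + C) <= 1.
  rewrite divr_ge0 ?mulr_ge0 ?(ltW mC)// ler_pdivrMr// mul1r.
  by lra.
move=> h1; have := le_trans (ler_wpM2r a0 (bernoulli_ler N x01)) h1.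
rewrite mulrBl mul1r lerBlDl -lerBlDr => h2.
have : (a - b) * (m%:R + C) <= N%:R * (2 * C) * a.
  rewrite -ler_pdivlMr//; apply: le_trans h2 _.
  by rewrite le_eqVlt; apply/orP; left; apply/eqP; ring.
rewrite -ler_pdivlMl// [leRHS]mulrC -/D leNgt => /negP; apply.
by lra.
Qed.

(** Take a largest linearly independent family in [A]. If it has fewer than n members, every point
    of [A] lies in its span, and any nonzero column of its cokernel matrix is a functional vanishing
    on [A]. *)
Lemma spanning_or_hyperplane n (A : set 'rV[R]_n) : A 0 ->
  (exists2 W : 'M[R]_n, W \in unitmx & forall i, A (row i W)) \/
  (exists2 u : 'cV[R]_n, u != 0 & forall x, A x -> x *m u = 0).
Proof.
move=> A0.
pose P r := `[<exists2 B : 'M[R]_(r, n), row_free B & forall i, A (row i B)>].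
have P0 : exists r, P r.
  by exists 0%N; apply/asboolP; exists 0 => [|[]//]; rewrite /row_free mxrank0.
have Pn r : P r -> (r <= n)%N.
  by move=> /asboolP[B /eqP fB _]; have := rank_leq_col B; rewrite fB.
case: (ex_maxnP P0 Pn) => r /asboolP[B fB AB] rmax.
have [rn|rn] := eqVneq r n.
  by left; subst r; exists B => //; rewrite -row_free_unit.
right; have BV x : A x -> x *m cokermx B = 0.
  move=> Ax; apply/eqP; rewrite -submxE; apply: contraT => xB.
  have : P r.+1.
    apply/asboolP; exists (col_mx x B : 'M[R]_((1 + r)%N, n)).
      have x1 : \rank x = 1%N.
        apply/eqP; rewrite eqn_leq rank_leq_row lt0n mxrank_eq0.
        by apply: contraNneq xB => ->; rewrite sub0mx.
      have dxB : \rank (x :&: B)%MS = 0%N.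
        have : (\rank (x :&: B)%MS < \rank x)%N;
          last by rewrite x1 ltnS leqn0 => /eqP.
        rewrite ltn_neqAle (mxrankS (capmxSl _ _)) andbT.
        apply: contra xB => /eqP e.
        have := mxrank_leqif_sup (capmxSl x B) => -[_].
        by rewrite e eqxx => /esym h; exact: submx_trans h (capmxSr _ _).
      have := mxrank_sum_cap x B; rewrite dxB addn0 x1 (eqP fB) addsmxE => h.
      by rewrite /row_free h.
    move=> i; case: (@split_ordP 1 r i) => j ->.
      suff : A (row (lshift r j) (col_mx x B)) by [].
      by rewrite rowKu row_id.
    suff : A (row (rshift 1 j) (col_mx x B)) by [].
    by rewrite rowKd.
  by move=> /rmax; rewrite ltnn.
have : cokermx B != 0.
  rewrite -mxrank_eq0 mxrank_coker (eqP fB) subn_eq0 -ltnNge ltn_neqAle rn/=.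
  by apply: Pn; apply/asboolP; exists B.
move=> /matrix0Pn[i [j ij]]; exists (col j (cokermx B)).
  by apply/matrix0Pn; exists i, 0; rewrite mxE.
by move=> x Ax; rewrite colE mulmxA BV// mul0mx.
Qed.

Lemma convexR_sum n (A : set 'rV[R]_n) (I : Type) (s : seq I) (c : I -> R) (a :
  I -> 'rV[R]_n) :
  convexR A -> A 0 -> (forall i, 0 <= c i) -> (forall i, A (a i)) ->
  \sum_(i <- s) c i <= 1 -> A (\sum_(i <- s) c i *: a i).
Proof.
move=> cA A0 c0 Aa s1.
(* The sum is written as its total weight times a point [b] of [A]; the missing weight is then given
   to the origin. If the total is 0, [b] is taken to be 0. *)
suff [b Ab ->] : exists2 b, A b & \sum_(i <- s) c i *: a i = (\sum_(i <- s) c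
  i) *: b.
  have := cA _ _ _ Ab A0 (sumr_ge0 _ (fun i _ => c0 i)) s1.
  by rewrite scaler0 addr0.
elim: s {s1} => [|i s [b Ab IH]]; first by exists 0;
  rewrite // !big_nil scaler0.
rewrite !big_cons IH; set t := \sum_(j <- s) c j.
have t0 : 0 <= t by exact: sumr_ge0.
have [e|ne] := eqVneq (c i + t) 0.
  exists 0 => //; have /andP[/eqP -> /eqP ->] : (c i == 0) && (t == 0).
    by rewrite -paddr_eq0// e.
  by rewrite !scale0r addr0 scaler0.
have gt0 : 0 < c i + t by rewrite lt0r ne addr_ge0.
exists (c i / (c i + t) *: a i + (1 - c i / (c i + t)) *: b).
  apply: cA => //; first by rewrite divr_ge0// ltW.
  by rewrite ler_pdivrMr// mul1r lerDl.
rewrite scalerDr !scalerA; congr (_ *: _ + _ *: _); field; exact: ne.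
Qed.

(** The box is centred at the barycentre of the simplex with vertices 0 and the rows of [W], where
    all coefficients are 1/N, N = n + 1. Dividing by [M], which bounds the column sums of |W^-1|,
    keeps the coefficients within 1/N^2 of 1/N: they stay nonnegative, with sum at most (N - 1)(1/N
    + 1/N^2) = 1 - 1/N^2. The summand 1 keeps [M] positive. *)
Lemma contains_box_of_basis n (A : set 'rV[R]_n) (W : 'M[R]_n) :
  convexR A -> A 0 -> W \in unitmx -> (forall i, A (row i W)) ->
  exists p, exists2 rho, 0 < rho & contains_box A p rho.
Proof.
move=> cA A0 uW AW.
pose N := n.+1%:R : R.
have N0 : 0 < N by rewrite ltr0Sn.
pose M := \sum_(i < n) \sum_(j < n) `|invmx W j i| + 1.
have M0 : 0 < M.
  by rewrite ltr_wpDl//; apply: sumr_ge0 => i _; apply: sumr_ge0.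
exists (const_mx N^-1 *m W), (N ^- 2 / M);
  first by rewrite divr_gt0// invr_gt0 exprn_gt0.
move=> x xp.
pose c := x *m invmx W.
have cN i : `|c 0 i - N^-1| <= N ^- 2.
  have -> : c 0 i - N^-1 = ((x - const_mx N^-1 *m W) *m invmx W) 0 i.
    by rewrite mulmxBl mulmxK// !mxE.
  rewrite mxE; apply: le_trans (ler_norm_sum _ _ _) _.
  apply: (@le_trans _ _ (\sum_j N ^- 2 / M * `|invmx W j i|)).
    apply: ler_sum => j _; rewrite normrM ler_wpM2r//.
    by have := xp j; rewrite !mxE.
  rewrite -mulr_sumr -mulrA ger_pMr ?invr_gt0 ?exprn_gt0// ler_pdivrMl// mulr1.
  rewrite /M ler_wpDr// [leRHS](bigD1 i)//= lerDl.
  by apply: sumr_ge0 => k _; apply: sumr_ge0.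
have -> : x = \sum_i c 0 i *: row i W by rewrite -mulmx_sum_row mulmxKV.
have NN : N ^- 2 <= N^-1.
  by rewrite lef_pV2 ?posrE ?exprn_gt0// expr2 ler_peMl ?(ltW N0)// ler1n.
apply: convexR_sum => // [i|].
  have := cN i; move: NN; move: (N ^- 2) (N^-1) => a b ab.
  by rewrite ler_norml => /andP[h1 h2]; lra.
apply: (@le_trans _ _ (\sum_(i < n) (N^-1 + N ^- 2))).
  apply: ler_sum => i _; have := cN i; move: (N ^- 2) (N^-1) => a b.
  by rewrite ler_norml => /andP[h1 h2]; lra.
rewrite sumr_const card_ord -mulr_natl.
have -> : n%:R = N - 1 by rewrite /N -natr1 addrK.
have -> : (N - 1) * (N^-1 + N ^- 2) = 1 - N ^- 2.
  by field; rewrite gt_eqF.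
by rewrite gerBl invr_ge0 exprn_ge0 ?ltW.
Qed.

(** For every N, the translates of [A] by (j/N)e, j < N, are disjoint when e lies off the
    hyperplane, and all lie in the thickening of [A] by 1. So N vol A is bounded by one finite
    volume for all N. *)
Lemma vol_hyperplane n (A : set 'rV[R]_n) (u : 'cV[R]_n) :
  borel_rV A -> coord_bounded A -> u != 0 -> (forall x, A x -> x *m u = 0) ->
  vol A = 0%E.
Proof.
move=> mA bA /matrix0Pn[i0 [j0 uij]] Au.
pose e : 'rV[R]_n := delta_mx 0 i0.
have eu : e *m u != 0.
  by apply/matrix0Pn; exists 0, j0; rewrite -rowE mxE.
pose T := [set x : 'rV[R]_n | exists2 y, A y & forall i, `|x 0 i - y 0 i| <= 1].
have bT : coord_bounded T.
  apply: (coord_bounded_thicken (m := 1) (s := 1) _ bA) => // x [y Ay xy].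
  by exists y; rewrite ?invr1 ?scale1r.
have [S [mS fS TS]] := coord_bounded_sub_fin_vol bT.
have fA := vol_fin_num mA bA.
pose F (N : nat) (j : nat) := [set x | A (x - (j%:R / N%:R) *: e)].
have mF N j : borel_rV (F N j).
  have := borel_affine 1 (- ((j%:R / N%:R) *: e)) mA.
  by congr borel_rV; apply/funext => x /=; rewrite scale1r.
have NS (N : nat) : (0 < N)%N -> N%:R * fine (vol A) <= fine (vol S).
  move=> N0.
  have : (vol (\bigcup_(j in `I_N) F N j) <= vol S)%E.
    apply: le_vol => //; first exact: borel_fin_bigcup.
    move=> x [j /= jN Fx]; apply: TS; exists (x - (j%:R / N%:R) *: e) => // i.
    rewrite !mxE opprB addrC subrK normrM eqxx/=.
    rewrite ger0_norm ?divr_ge0// -[leRHS]mulr1 ler_pM ?divr_ge0//.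
      by rewrite ler_pdivrMr ?ltr0n// mul1r ler_nat ltnW.
    by case: (_ == _); rewrite ?normr1 ?normr0.
  rewrite vol_fin_bigcup//; last first.
    move=> j k jN kN [x [/= /Au hj /Au hk]].
    have : (x - (k%:R / N%:R) *: e) *m u - (x - (j%:R / N%:R) *: e) *m u = 0.
      by rewrite hj hk subrr.
    rewrite -mulmxBl opprB [X in X *m u]addrC addrA subrK -scalerBl -scalemxAl
      => /eqP.
    rewrite scaler_eq0 (negPf eu) orbF subr_eq0 => /eqP.
    move=> /(congr1 (fun z => z * N%:R)); rewrite !divfK ?pnatr_eq0 ?gtn_eqF//.
    by move=> /eqP; rewrite eqr_nat => /eqP.
  rewrite (eq_fsbigr (fun=> vol A)); last first.
    move=> j _; rewrite -!vol_mx1 -(vol_mx_shift (unitmx1 _ _) (- ((j%:R /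
      N%:R) *: e)) mA).
    by [].
  rewrite fsbig_finite//= big_const_seq count_predT iter_addr_0.
  rewrite (@card_fset_set _ `I_N N)// => h.
  have : ((N%:R)%:E * vol A <= vol S)%E by rewrite mule_natl.
  rewrite -(fineK fA) -(fineK fS) -EFinM lee_fin.
  by [].
rewrite -(fineK fA); congr (_%:E); apply/eqP;
  rewrite eq_le fine_ge0 ?vol_ge0// andbT.
rewrite leNgt; apply/negP => v0.
have := NS (Num.truncn (fine (vol S) / fine (vol A))).+1 isT.
by rewrite -ler_pdivlMr// leNgt truncnS_gt.
Qed.

End ConvexBodies.

(** * Rotation invariance *)

Section VolumeCounting.
Variable R : realType.

Lemma vol_count_lower n (A : set 'rV[R]_n) :
  convexR A -> borel_rV A -> coord_bounded A -> A 0 ->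
  exists2 C, 0 <= C & forall m : nat, C < m%:R ->
    (m%:R - C) ^+ n * fine (vol A) <= (G_n (dilate m%:R A))%:R.
Proof.
move=> cA mA bA A0; have [[W uW AW]|[u u0 Au]] := spanning_or_hyperplane A0.
  have [p [rho rho0 Ap]] := contains_box_of_basis cA A0 uW AW.
  exists rho^-1; first by rewrite invr_ge0 ltW.
  move=> m hm; have := count_lower (unitmx1 _ _) mA cA bA rho0 Ap hm.
  by rewrite !vol_mx1 vol_unit_cube mulr1.
exists 0 => // m _; rewrite (vol_hyperplane mA bA u0 Au) mulr0.
exact: ler0n.
Qed.

Lemma vol_count_upper n (A : set 'rV[R]_n) (p : 'rV[R]_n) (rho s : R) :
  convexR A -> borel_rV A -> coord_bounded A -> 0 < rho -> contains_box A p rho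
    ->
  0 <= s ->
  exists2 C, 0 <= C & forall m : nat, (0 < m)%N ->
    (G_n (minkowski_sum (dilate m%:R A) (open_cube n s)))%:R
      <= (m%:R + C) ^+ n * fine (vol A).
Proof.
move=> cA mA bA rho0 Ap s0; exists ((s + 1) / rho).
  by rewrite divr_ge0 ?addr_ge0// ltW.
move=> m m0.
have := @count_upper _ _ _ _ _ _ (unitmx1 _ _) mA cA bA rho0 Ap s
  (minkowski_sum (dilate m%:R A) (open_cube n s)) m s0 m0.
rewrite !vol_mx1 vol_unit_cube mulr1; apply=> _ [y Ay [w ws <-]].
exists y => // i; rewrite mxE addrAC subrr add0r ler_norml.
by have /andP[h1 h2] := ws i; rewrite !ltW.
Qed.

(** One and the same count, of the lattice points of mA, estimates both volumes. Playing the lower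
    bound for [O] against the upper bound for the identity, and conversely, eliminates the count. *)
Lemma vol_mx_proportional n (O : 'M[R]_n) A (p : 'rV[R]_n) (rho : R) :
  O \in unitmx -> convexR A -> borel_rV A -> coord_bounded A ->
  0 < rho -> contains_box A p rho ->
  fine (vol_mx O A) = fine (vol A) * fine (vol_mx O (@unit_cube R n)).
Proof.
move=> uO cA mA bA rho0 Ap.
have C0 : 0 <= rho^-1 by rewrite invr_ge0 ltW.
have up (U : 'M[R]_n) : U \in unitmx -> forall m : nat, rho^-1 < m%:R ->
    (G_n (dilate m%:R A))%:R * fine (vol_mx U (@unit_cube R n))
      <= (m%:R + rho^-1) ^+ n * fine (vol_mx U A).
  move=> uU m Cm; have := @count_upper _ _ _ _ _ _ uU mA cA bA rho0 Ap 0
    (dilate m%:R A) m (lexx _).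
  rewrite add0r mul1r; apply.
    by rewrite -(ltr0n R) (le_lt_trans C0).
  by move=> x Ax; exists x => // i; rewrite subrr normr0.
have vge0 (U : 'M[R]_n) B : 0 <= fine (vol_mx U B) by rewrite fine_ge0//
  vol_mx_ge0.
have v1 : fine (vol_mx 1%:M (@unit_cube R n)) = 1 by rewrite vol_mx1
  vol_unit_cube.
apply/eqP; rewrite eq_le; apply/andP; split.
  apply: (polynomial_growth_le C0 (vge0 _ _) (N := n)) => m Cm.
  apply: le_trans (count_lower uO mA cA bA rho0 Ap Cm) _.
  rewrite mulrA ler_wpM2r//.
  by have := up _ (unitmx1 _ _) _ Cm; rewrite v1 mulr1 vol_mx1.
apply: (polynomial_growth_le C0 _ (N := n)) => [|m Cm].
  by rewrite mulr_ge0// fine_ge0// vol_ge0.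
apply: le_trans (up _ uO _ Cm); rewrite mulrA ler_wpM2r//.
by have := count_lower (unitmx1 _ _) mA cA bA rho0 Ap Cm;
  rewrite v1 mulr1 vol_mx1.
Qed.

Definition unit_ball n : set 'rV[R]_n := [set x | dotrV x x <= 1].

Lemma dotrV_mulmx n (x y : 'rV[R]_n) : dotrV x y = (x *m y^T) 0 0.
Proof. by rewrite mxE; apply: eq_bigr => i _; rewrite !mxE. Qed.

Lemma borel_unit_ball n : borel_rV (@unit_ball n).
Proof.
have mf : measurable_fun setT (fun t : sfs_carrier (lebesgue_space R n) =>
   dotrV (rV_of_lebesgue_space t) (rV_of_lebesgue_space t)).
  apply: measurable_sum => i; apply: measurable_funM; exact: measurable_coord.
have := mf measurableT _ (measurable_itv `]-oo, 1%R]); rewrite setTI.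
by congr measurable; apply/funext => t; rewrite /preimage /= in_itv.
Qed.

Lemma unit_ball_coord n x i : @unit_ball n x -> `|x 0 i| <= 1.
Proof.
rewrite /unit_ball /= => h;
  rewrite -(@ler_pXn2r _ 2)// ?nnegrE// expr1n real_normK ?num_real//.
apply: le_trans h; rewrite /dotrV (bigD1 i)//= expr2 lerDl.
by apply: sumr_ge0 => j _; rewrite -expr2 sqr_ge0.
Qed.

Lemma unit_ball_convex n : convexR (@unit_ball n).
Proof.
move=> x y t hx hy t0 t1; rewrite /unit_ball /=.
apply: (@le_trans _ _ (t * dotrV x x + (1 - t) * dotrV y y)).
  rewrite /dotrV !mulr_sumr -big_split/=; apply: ler_sum => i _; rewrite !mxE.
  rewrite -subr_ge0.
  have -> : t * (x 0 i * x 0 i) + (1 - t) * (y 0 i * y 0 i) -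
    (t * x 0 i + (1 - t) * y 0 i) * (t * x 0 i + (1 - t) * y 0 i) =
    t * (1 - t) * (x 0 i - y 0 i) ^+ 2 by ring.
  by apply: mulr_ge0; [apply: mulr_ge0; rewrite ?subr_ge0|exact: sqr_ge0].
rewrite -[leRHS](_ : t * 1 + (1 - t) * 1 = 1); last by ring.
by rewrite lerD// ler_wpM2l// subr_ge0.
Qed.

(** The sum of n squares, each at most 1/(n + 1), is below 1; n + 1 keeps the radius meaningful for
    n = 0. *)
Lemma unit_ball_box n : contains_box (@unit_ball n) 0 n.+1%:R^-1.
Proof.
move=> x xn; rewrite /unit_ball /=.
apply: (@le_trans _ _ (\sum_(i < n) n.+1%:R^-1)).
  apply: ler_sum => i _; have := xn i; rewrite mxE subr0 => h.
  rewrite -expr2 -real_normK ?num_real// expr2 -[leRHS]mulr1 ler_pM//.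
  by apply: le_trans h _; rewrite invf_le1 ?ler1n// ltr0Sn.
rewrite sumr_const card_ord -[_ *+ n]mulr_natl ler_pdivrMr ?ltr0Sn// mul1r
  ler_nat.
exact: leqnSn.
Qed.

Lemma vol_box_gt0 n (A : set 'rV[R]_n) p rho : borel_rV A -> coord_bounded A ->
  0 < rho -> contains_box A p rho -> 0 < fine (vol A).
Proof.
move=> mA bA rho0 Ap; apply: (@lt_le_trans _ _ (rho ^+ n));
  first by rewrite exprn_gt0.
rewrite -lee_fin fineK ?vol_fin_num//.
have := vol_mx_dilate (- (rho^-1 *: p)) (unitmx1 _ _) rho0 (@borel_unit_cube R
  n).
rewrite !vol_mx1 vol_unit_cube mule1 => <-.
apply: le_vol => //; first exact/borel_affine/borel_unit_cube.
move=> x hx; apply: Ap => i; have := hx i; rewrite !mxE -mulrBr => /andP[h1 h2].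
rewrite pmulr_rge0 ?invr_gt0// in h1.
rewrite ltr_pdivrMl// mulr1 in h2.
by rewrite ger0_norm// ltW.
Qed.

Lemma vol_orthogonal n (O : 'M[R]_n) A (p : 'rV[R]_n) (rho : R) :
  O *m O^T = 1%:M -> convexR A -> borel_rV A -> coord_bounded A ->
  0 < rho -> contains_box A p rho ->
  vol [set x | A (x *m O)] = vol A.
Proof.
move=> OO cA mA bA rho0 Ap.
have [uO _] := mulmx1_unit OO.
have vB : fine (vol_mx O (@unit_ball n)) = fine (vol (@unit_ball n)).
  congr (fine (vol _)); apply/funext => x /=;
    rewrite /unit_ball /= !dotrV_mulmx.
  by rewrite trmx_mul mulmxA -(mulmxA x) OO mulmx1.
have bB : coord_bounded (@unit_ball n) by exists 1%N => x /unit_ball_coord.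
have N0 : 0 < n.+1%:R^-1 :> R by rewrite invr_gt0 ltr0Sn.
have vB0 := vol_box_gt0 (@borel_unit_ball n) bB N0 (@unit_ball_box n).
have := vol_mx_proportional uO (@unit_ball_convex n) (@borel_unit_ball n) bB N0
  (@unit_ball_box n).
rewrite vB => e.
(* The ball is its own preimage under [O], and its volume is positive, so it cancels from the
   proportionality. *)
have vQ : fine (vol_mx O (@unit_cube R n)) = 1.
  by apply: (mulfI (lt0r_neq0 vB0)); rewrite -e mulr1.
have := vol_mx_proportional uO cA mA bA rho0 Ap; rewrite vQ mulr1.
move=> eA; rewrite -[RHS](fineK (vol_fin_num mA bA)) -eA fineK//.
exact: vol_mx_fin_num.
Qed.

End VolumeCounting.

(** * Compactness and dimension *)

Section Compactness.
Variable R : realType.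

Lemma mulmx_continuous n m (O : 'M[R]_(n, m)) : continuous (fun x : 'rV[R]_n =>
  x *m O).
Proof.
move=> x B /= /nbhs_ballP[e /= e0 eB].
pose M := \sum_i \sum_j `|O i j| + 1.
have M0 : 0 < M by rewrite ltr_wpDl//; apply: sumr_ge0 => i _; apply: sumr_ge0.
apply/nbhs_ballP; exists (e / M); first by rewrite /= divr_gt0.
move=> y [_ xy]; apply: eB; split=> // i j; rewrite ord1 /ball /=.
have -> : (x *m O) 0 j - (y *m O) 0 j = ((x - y) *m O) 0 j.
  by rewrite mulmxBl !mxE.
rewrite mxE; apply: le_lt_trans (ler_norm_sum _ _ _) _.
apply: (@le_lt_trans _ _ (\sum_k e / M * `|O k j|)).
  apply: ler_sum => k _; rewrite normrM ler_wpM2r//.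
  by have := xy 0 k; rewrite /ball /= !mxE => /ltW.
rewrite -mulr_sumr -mulrA gtr_pMr// ltr_pdivrMl// mulr1 ltr_pwDr//.
apply: ler_sum => k _; rewrite (bigD1 j)//= lerDl.
exact: sumr_ge0.
Qed.

Lemma compact_mulmx n m (O : 'M[R]_(n, m)) (A : set 'rV[R]_n) :
  compact A -> compact [set x *m O | x in A].
Proof. by apply: continuous_compact;
  exact/continuous_subspaceT/mulmx_continuous. Qed.

Lemma compact_dilate n (A : set 'rV[R]_n) (m : R) :
  m != 0 -> compact A -> compact (dilate m A).
Proof.
move=> m0 /(compact_mulmx (O := m%:M)); rewrite dilateE//; congr compact.
by apply/seteqP; split=> _ [x Ax <-]; exists x => //; rewrite mul_mx_scalar.
Qed.

Lemma compact_oppset n (A : set 'rV[R]_n) : compact A -> compact (oppset A).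
Proof.
move=> /(compact_mulmx (O := (-1)%:M)); congr compact.
by apply/seteqP; split=> _ [x Ax <-]; exists x => //;
  rewrite mul_mx_scalar scaleN1r.
Qed.

Lemma compact_minkowski n (A B : set 'rV[R]_n) :
  compact A -> compact B -> compact (minkowski_sum A B).
Proof.
move=> cA cB; have := compact_setX cA cB => cAB.
have := @continuous_compact _ _ (fun z : 'rV[R]_n * 'rV[R]_n => z.1 + z.2) _
  (continuous_subspaceT (@add_continuous _)) cAB.
congr compact; apply/seteqP;
  split=> [_ [[x y] [/= Ax By] <-]|_ [x Ax [y By <-]]].
  by exists x => //; exists y.
by exists (x, y).
Qed.

Lemma compact_borel n (A : set 'rV[R]_n) : compact A -> borel_rV A.
Proof. by move=> cA; apply: closed_borel; apply: compact_closed => //;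
  exact: norm_hausdorff. Qed.

Lemma compact_coord_bounded n (A : set 'rV[R]_n) : compact A -> coord_bounded A.
Proof. by move=> /compact_bounded; exact: bounded_coord_bounded. Qed.

Lemma convexR_dilate n (A : set 'rV[R]_n) (m : R) : convexR A -> convexR
  (dilate m A).
Proof.
move=> cA x y t Ax Ay t0 t1;
  rewrite /dilate /= scalerDr !scalerA ![m^-1 * _]mulrC -!scalerA.
exact: cA.
Qed.

Lemma convexR_mulmx n m (O : 'M[R]_(m, n)) (A : set 'rV[R]_n) :
  convexR A -> convexR [set x | A (x *m O)].
Proof.
move=> cA x y t Ax Ay t0 t1; rewrite /= mulmxDl -!scalemxAl; exact: cA.
Qed.

Lemma convexR_oppset n (A : set 'rV[R]_n) : convexR A -> convexR (oppset A).
Proof.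
move=> cA _ _ t [x Ax <-] [y Ay <-] t0 t1; exists (t *: x + (1 - t) *: y);
  first exact: cA.
by rewrite opprD !scalerN.
Qed.

Lemma convexR_minkowski n (A B : set 'rV[R]_n) :
  convexR A -> convexR B -> convexR (minkowski_sum A B).
Proof.
move=> cA cB _ _ t [x Ax [y By <-]] [x' Ax' [y' By' <-]] t0 t1.
exists (t *: x + (1 - t) *: x'); first exact: cA.
exists (t *: y + (1 - t) *: y'); first exact: cB.
by rewrite !scalerDr addrACA.
Qed.

(** A subspace of dimension n is everything, so the affine hull is the whole space; a linear
    functional vanishing on [A] would vanish on that hull and be zero. *)
Lemma full_dim_box n (A : set 'rV[R]_n) : convexR A -> A 0 -> has_dim A n ->
  exists p, exists2 rho, 0 < rho & contains_box A p rho.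
Proof.
move=> cA A0 [p [V [hV dV]]].
have VT : V = fullv by apply/eqP; rewrite eqEdim subvf dV dimvf /dim /= mul1n.
have [[W uW AW]|[u u0 Au]] := spanning_or_hyperplane A0.
  exact: contains_box_of_basis AW.
case/eqP: u0.
have all0 (x : 'rV[R]_n) : x *m u = 0.
  have : affine_hull A x.
    rewrite hV; exists (x - p); first by rewrite /= VT memvf.
    by rewrite addrC subrK.
  move=> [m [a [c [Aa _ ->]]]]; rewrite mulmx_suml big1// => i _.
  by rewrite -scalemxAl Au// scaler0.
apply/matrixP => i j; have := all0 (delta_mx 0 i);
  rewrite -rowE => /matrixP/(_ 0 j).
by rewrite !mxE.
Qed.

(** [fset_set] sends infinite sets to the empty one, so comparing cardinals requires [B] finite;
    finiteness of [A] follows by injectivity. *)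
Lemma card_fset_set_inj (T U : choiceType) (f : T -> U) (A : set T) (B : set U)
  :
  injective f -> finite_set B -> (forall x, A x -> B (f x)) ->
  (#|` fset_set A| <= #|` fset_set B|)%N.
Proof.
move=> fi fB AB.
have fA : finite_set A.
  apply: sub_finite_set AB _; apply: finite_preimage => // x y _ _; exact: fi.
have <- : #|` (f @` (fset_set A))%fset| = #|` fset_set A| by rewrite
  card_imfset.
apply: fsubset_leq_card.
apply/fsubsetP => y /imfsetP[x /= xA ->]; rewrite in_fset_set// in xA.
by rewrite in_fset_set//; apply/mem_set/AB/set_mem.
Qed.

End Compactness.

(** * The two implications *)

Section Implications.
Variable R : realType.

(** The constant may be enlarged at will, so that the bounds for several bodies can be multiplied
    with one common [C']. *)
Lemma count_growth_lower n (A : set 'rV[R]_n) :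
  convexR A -> borel_rV A -> coord_bounded A -> A 0 ->
  exists2 C, 0 <= C & forall (C' : R) (m : nat), C <= C' -> C' < m%:R ->
    (m%:R - C') ^+ n * fine (vol A) <= (G_n (dilate m%:R A))%:R.
Proof.
move=> cA mA bA A0; have [C C0 hC] := vol_count_lower cA mA bA A0.
exists C => // C' m CC' C'm.
apply: le_trans (hC m (le_lt_trans CC' C'm)).
rewrite ler_wpM2r ?fine_ge0 ?vol_ge0// lerXn2r ?nnegrE ?subr_ge0 ?(ltW C'm)//.
  by apply: ltW; exact: le_lt_trans C'm.
by rewrite lerB.
Qed.

Lemma count_growth_upper n (A : set 'rV[R]_n) p rho s :
  convexR A -> borel_rV A -> coord_bounded A -> 0 < rho -> contains_box A p rho
    ->
  0 <= s ->
  exists2 C, 0 <= C & forall (C' : R) (m : nat), C <= C' -> (0 < m)%N ->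
    (G_n (minkowski_sum (dilate m%:R A) (open_cube n s)))%:R
      <= (m%:R + C') ^+ n * fine (vol A).
Proof.
move=> cA mA bA rho0 Ap s0.
have [C C0 hC] := vol_count_upper cA mA bA rho0 Ap s0.
exists C => // C' m CC' m0; apply: le_trans (hC m m0) _.
rewrite ler_wpM2r ?fine_ge0 ?vol_ge0// lerXn2r ?nnegrE ?addr_ge0//.
  exact: le_trans CC'.
by rewrite lerD.
Qed.

Lemma dilate_minkowski n (m : R) (A B : set 'rV[R]_n) : m != 0 ->
  dilate m (minkowski_sum A B) = minkowski_sum (dilate m A) (dilate m B).
Proof.
move=> m0; rewrite !dilateE//; apply/seteqP; split.
  move=> _ [_ [x Ax [y By <-]] <-].
  by exists (m *: x); [exists x|exists (m *: y); [exists y|rewrite scalerDr]].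
move=> _ [_ [x Ax <-] [_ [y By <-] <-]]; exists (x + y);
  last by rewrite scalerDr.
by exists x => //; exists y.
Qed.

Lemma dilate_oppset n (m : R) (A : set 'rV[R]_n) : m != 0 ->
  dilate m (oppset A) = oppset (dilate m A).
Proof.
move=> m0; rewrite !dilateE//; apply/seteqP; split.
  by move=> _ [_ [x Ax <-] <-]; exists (m *: x); [exists x|rewrite scalerN].
by move=> _ [_ [x Ax <-] <-]; exists (- x); [exists x|rewrite scalerN].
Qed.

Lemma rogers_shephard_of_discrete n (K L : set 'rV[R]_n)
    (K_compact : compact K) (K_convex : convex_set K) (K0 : K 0)
    (K_dim : has_dim K n)
    (L_compact : compact L) (L_convex : convex_set L) (L0 : L 0)
    (L_dim : has_dim L n) :
  (forall M N : set 'rV[R]_n,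
      convex_set M -> bounded_set M -> M 0 ->
      convex_set N -> bounded_set N -> N 0 ->
      (G_n (minkowski_sum M N) * G_n (M `&` oppset N)
       <= 'C(2 * n, n) * G_n (minkowski_sum M (open_cube n 1))
            * G_n (minkowski_sum N (open_cube n 2)))%N) ->
   (vol (minkowski_sum K L) * vol (K `&` oppset L)
    <= ('C(2 * n, n))%:R%:E * vol K * vol L)%E.
Proof.
move=> disc; move/convex_setP in K_convex; move/convex_setP in L_convex.
have [pK [rK rK0 boxK]] := full_dim_box K_convex K0 K_dim.
have [pL [rL rL0 boxL]] := full_dim_box L_convex L0 L_dim.
pose S := minkowski_sum K L; pose T := K `&` oppset L.
have cS : compact S by exact: compact_minkowski.
have cT : compact T.
  apply: compact_closedI => //; apply: compact_closed;
    first exact: norm_hausdorff.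
  exact: compact_oppset.
have S0 : S 0 by exists 0 => //; exists 0; rewrite // addr0.
have T0 : T 0 by split=> //; exists 0; rewrite ?oppr0.
have vxS : convexR S by exact: convexR_minkowski.
have vxT : convexR T.
  move=> x y t [Kx Lx] [Ky Ly] t0 t1; split; first exact: K_convex.
  exact: convexR_oppset.
have [C1 C10 lS] := count_growth_lower vxS (compact_borel cS)
  (compact_coord_bounded cS) S0.
have [C2 C20 lT] := count_growth_lower vxT (compact_borel cT)
  (compact_coord_bounded cT) T0.
have [C3 C30 uK] := count_growth_upper K_convex (compact_borel K_compact)
  (compact_coord_bounded K_compact) rK0 boxK ler01.
have [C4 C40 uL] := count_growth_upper L_convex (compact_borel L_compact)
  (compact_coord_bounded L_compact) rL0 boxL (ler0n _ 2).
have fin (A : set 'rV[R]_n) : compact A -> vol A = (fine (vol A))%:E.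
  by move=> cA; rewrite fineK// vol_fin_num//;
    [exact: compact_borel|exact: compact_coord_bounded].
have vge0 (A : set 'rV[R]_n) : 0 <= fine (vol A) by rewrite fine_ge0 ?vol_ge0.
rewrite (fin S cS) (fin T cT) (fin K K_compact) (fin L L_compact) -!EFinM
  lee_fin.
(* One constant for all four bounds; the common degree is n + n, as each side is a product of two
   n-dimensional volumes. *)
pose C := C1 + C2 + C3 + C4.
have C0 : 0 <= C by rewrite /C !addr_ge0.
apply: (polynomial_growth_le C0 _ (N := n + n)) => [|m Cm];
  first by rewrite mulr_ge0.
have m0 : 0 < m%:R :> R by exact: le_lt_trans Cm.
have m0N : (0 < m)%N by rewrite -(ltr0n R).
have mn0 : m%:R != 0 :> R by rewrite gt_eqF.
have mC : 0 <= m%:R - C by rewrite subr_ge0 ltW.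
have [c1 c2 c3 c4] : [/\ C1 <= C, C2 <= C, C3 <= C & C4 <= C].
  by rewrite /C; split; lra.
have hS := lS C m c1 Cm; have hT := lT C m c2 Cm.
have hK := uK C m c3 m0N; have hL := uL C m c4 m0N.
have bdd (A : set 'rV[R]_n) : compact A -> bounded_set (dilate m%:R A).
  by move=> cA; apply: compact_bounded; exact: compact_dilate.
have dil0 (A : set 'rV[R]_n) : A 0 -> dilate m%:R A 0 by rewrite /dilate /=
  scaler0.
have := disc (dilate m%:R K) (dilate m%:R L)
  (proj2 (convex_setP _) (@convexR_dilate _ _ _ m%:R K_convex)) (bdd _
    K_compact) (dil0 _ K0)
  (proj2 (convex_setP _) (@convexR_dilate _ _ _ m%:R L_convex)) (bdd _
    L_compact) (dil0 _ L0).
(* Dilation commutes with sum, reflection and intersection, so the counts on the left are those of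
   mS and mT. *)
rewrite -dilate_minkowski// -dilate_oppset// -[_ `&` _]/(dilate m%:R T).
rewrite -/S -(ler_nat R) !natrM => hd.
rewrite exprD mulrACA; apply: le_trans (ler_pM _ _ hS hT) _.
- by rewrite mulr_ge0// exprn_ge0.
- by rewrite mulr_ge0// exprn_ge0.
apply: le_trans hd _.
have -> : (m%:R + C) ^+ (n + n) * ('C(2 * n, n)%:R * fine (vol K) * fine (vol
  L)) =
  'C(2 * n, n)%:R * ((m%:R + C) ^+ n * fine (vol K)) * ((m%:R + C) ^+ n * fine
    (vol L)).
  by rewrite exprD; ring.
by rewrite !ler_pM// ?mulr_ge0// ler_wpM2l.
Qed.

End Implications.

(** * Projection and section for the coordinate subspace *)

Section CoordinateSubspace.
Variable R : realType.

Lemma coord_subspaceP n k (x : 'rV[R]_n) :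
  (x \in coord_subspace R n k) <-> (forall i : 'I_n, (k <= i)%N -> x 0 i = 0).
Proof.
pose X := [seq (delta_mx 0 i : 'rV[R]_n) | i : 'I_n <- enum 'I_n & (i < k)%N].
rewrite -[coord_subspace R n k]/<<in_tuple X>>%VS.
split=> [/coord_span -> i ki|h].
  rewrite summxE big1// => j _; rewrite mxE.
  have /mapP[l] : (in_tuple X)`_j \in X by apply: mem_nth.
  rewrite mem_filter => /andP[lk _] ->; rewrite mxE eqxx /=.
  have -> : (i == l) = false by apply/eqP => il; move: lk;
    rewrite -il ltnNge ki.
  by rewrite mulr0.
rewrite [x]row_sum_delta; apply: memv_suml => i _.
have [ki|ik] := leqP k i; first by rewrite h// scale0r mem0v.
apply/memvZ/memv_span/mapP; exists i => //.
by rewrite mem_filter ik mem_enum.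
Qed.

Lemma dotrV_delta n (x : 'rV[R]_n) i : dotrV x (delta_mx 0 i) = x 0 i.
Proof.
rewrite /dotrV (bigD1 i)//= mxE !eqxx mulr1 big1 ?addr0// => j ji.
by rewrite mxE (negPf ji) andbF mulr0.
Qed.

Lemma orth_coord_subspaceP n k (x : 'rV[R]_n) :
  orth [set` coord_subspace R n k] x <-> (forall i : 'I_n, (i < k)%N -> x 0 i =
    0).
Proof.
split=> [h i ik|h y /coord_subspaceP hy].
  rewrite -dotrV_delta; apply: h; apply/coord_subspaceP => j kj.
  by rewrite mxE [j == i](_ : _ = false)//; apply/eqP => ji; move: ik;
    rewrite -ji ltnNge kj.
rewrite /dotrV big1// => i _; have [ki|ik] := leqP k i.
  by rewrite hy// mulr0.
by rewrite h// mul0r.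
Qed.

Lemma orth_orth_coord_subspaceP n k (x : 'rV[R]_n) :
  orth (orth [set` coord_subspace R n k]) x <-> (forall i : 'I_n, (k <= i)%N ->
    x 0 i = 0).
Proof.
split=> [h i ki|h y /orth_coord_subspaceP hy].
  rewrite -dotrV_delta; apply: h; apply/orth_coord_subspaceP => j jk.
  by rewrite mxE [j == i](_ : _ = false)//; apply/eqP => ji; move: jk;
    rewrite ji ltnNge ki.
rewrite /dotrV big1// => i _; have [ki|ik] := leqP k i.
  by rewrite h// mul0r.
by rewrite hy// mulr0.
Qed.

Lemma row_mx_eq0r k d (x : 'rV[R]_(k + d)) :
  (forall i : 'I_(k + d), (k <= i)%N -> x 0 i = 0) <-> rsubmx x = 0.
Proof.
split=> [h|h i ki]; first by apply/rowP => i; rewrite !mxE h//= leq_addr.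
have := ltn_ord i; case: (split_ordP i) => j e; subst i; first by move: ki;
  rewrite leqNgt /= ltn_ord.
by move=> _; have /rowP/(_ j) := h; rewrite !mxE.
Qed.

Lemma row_mx_eq0l k d (x : 'rV[R]_(k + d)) :
  (forall i : 'I_(k + d), (i < k)%N -> x 0 i = 0) <-> lsubmx x = 0.
Proof.
split=> [h|h i ik]; first by apply/rowP => i; rewrite !mxE h//= ltn_ord.
case: (split_ordP i) ik => j -> //.
by move=> _; have /rowP/(_ j) := h; rewrite !mxE.
Qed.

Lemma integer_points_row_mx k d (a : 'rV[R]_k) (c : 'rV[R]_d) :
  integer_points a -> integer_points c -> integer_points (row_mx a c).
Proof.
move=> ia ic i; case: (split_ordP i) => j ->; first by rewrite row_mxEl;
  exact: ia.
by rewrite row_mxEr; exact: ic.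
Qed.

Lemma integer_points0 n : integer_points (0 : 'rV[R]_n).
Proof. by move=> i; rewrite mxE. Qed.

(** One inequality is enough, here and for [G_last]: both counts stand on the smaller side of the
    discrete inequality, where they are bounded below. *)
Lemma G_n_le_G_first k d (M : set 'rV[R]_(k + d)) : coord_bounded M ->
  (G_n [set c : 'rV[R]_k | M (row_mx c 0)]
     <= G_first k (M `&` [set` coord_subspace R (k + d) k]))%N.
Proof.
move=> bM; apply: (@card_fset_set_inj _ _ (fun c : 'rV[R]_k => row_mx c (0 :
  'rV[R]_d))).
- by move=> a b /eq_row_mx[].
- apply: sub_finite_set (finite_integer_points bM).
  by move=> x [[Mx _] [ix _]].
- move=> c [/= Mc ic];
  have h : forall i : 'I_(k + d), (k <= i)%N -> row_mx c 0 0 i = 0.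
    by apply/row_mx_eq0r; rewrite row_mxKr.
  split; first by split=> //; apply/coord_subspaceP.
  by split=> //; apply: integer_points_row_mx => //; exact: integer_points0.
Qed.

Lemma G_n_le_G_last k d (M : set 'rV[R]_(k + d)) : coord_bounded M ->
  (G_n [set c : 'rV[R]_d | exists a, M (row_mx a c)]
     <= G_last k (oproj (orth [set` coord_subspace R (k + d) k]) M))%N.
Proof.
move=> [N MN]; apply: (@card_fset_set_inj _ _ (fun c : 'rV[R]_d => row_mx (0 :
  'rV[R]_k) c)).
- by move=> a b /eq_row_mx[].
(* Projected points have zero leading coordinates and inherit the others from [M], so there are
   finitely many integer ones and the count is meaningful. *)
- have bN : coord_bounded [set y : 'rV[R]_(k + d) | forall i, `|y 0 i| <= N%:R]
  by exists N.
  apply: sub_finite_set (finite_integer_points bN).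
  move=> y [[/orth_coord_subspaceP hy [x Mx /orth_orth_coord_subspaceP hxy]]
    [iy _]].
    split=> // i; have [ki|ik] := leqP k i; last by rewrite hy// normr0.
    have := hxy i ki; rewrite !mxE => /eqP; rewrite subr_eq0 => /eqP <-.
    exact: MN.
- move=> c [/= [a Mac] ic].
  have h : forall i : 'I_(k + d), (i < k)%N -> row_mx 0 c 0 i = 0.
    by apply/row_mx_eq0l; rewrite row_mxKl.
  split; last by split=> //; apply: integer_points_row_mx => //;
    exact: integer_points0.
  split; first exact/orth_coord_subspaceP.
  exists (row_mx a c) => //; apply/orth_orth_coord_subspaceP/row_mx_eq0r.
  by rewrite linearB/= !row_mxKr subrr.
Qed.

Lemma projection_section_coord k d (K : set 'rV[R]_(k + d)) p rho :
  compact K -> convexR K -> K 0 -> 0 < rho -> contains_box K p rho ->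
  let H0 := [set` coord_subspace R (k + d) k] in
  (forall M : set 'rV[R]_(k + d), M !=set0 -> convex_set M -> bounded_set M ->
     (G_last k (oproj (orth H0) M) * G_first k (M `&` H0)
      <= 'C(k + d, k) * G_n (minkowski_sum M (open_cube (k + d) 1)))%N) ->
  (vol [set c : 'rV[R]_d | exists a, K (row_mx a c)]
     * vol [set c : 'rV[R]_k | K (row_mx c 0)]
   <= ('C(k + d, k))%:R%:E * vol K)%E.
Proof.
move=> cK vK K0 rho0 Kp H0 disc.
set P := [set c : 'rV[R]_d | _]; set S := [set c : 'rV[R]_k | _].
(* A linear image of a Borel set need not be Borel, so [P] is handled as a compact image; the
   section [S] is a linear preimage. *)
have cP : compact P.
  have := compact_mulmx (O := col_mx 0 1%:M : 'M[R]_(k + d, d)) cK;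
    congr compact.
  apply/seteqP; split=> [_ [x Kx <-]|c [a Kac]].
    exists (lsubmx x); rewrite -[x in X in row_mx _ X]hsubmxK mul_row_col
      mulmx0 add0r mulmx1.
    by rewrite hsubmxK.
  by exists (row_mx a c) => //; rewrite mul_row_col mulmx0 add0r mulmx1.
have SE : S = [set c | K (c *m row_mx 1%:M 0)].
  by apply/funext => c; rewrite /S /= mul_mx_row mulmx1 mulmx0.
have mS : borel_rV S by rewrite SE; exact/borel_mulmx/compact_borel.
have [N KN] := compact_coord_bounded cK.
have bS : coord_bounded S.
  by exists N => c /KN h i; have := h (lshift d i); rewrite row_mxEl.
have vS : convexR S by rewrite SE; exact: convexR_mulmx.
have vP : convexR P.
  move=> c c' t [a Ka] [a' Ka'] t0 t1; exists (t *: a + (1 - t) *: a').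
  by rewrite -add_row_mx -!scale_row_mx; exact: vK.
have S0 : S 0 by rewrite /S /= row_mx0.
have P0 : P 0 by exists 0; rewrite row_mx0.
have [C1 C10 lS] := count_growth_lower vS mS bS S0.
have [C2 C20 lP] := count_growth_lower vP (compact_borel cP)
  (compact_coord_bounded cP) P0.
have [C3 C30 uK] := count_growth_upper vK (compact_borel cK)
  (compact_coord_bounded cK) rho0 Kp ler01.
have finS := vol_fin_num mS bS.
have finP := vol_fin_num (compact_borel cP) (compact_coord_bounded cP).
have finK := vol_fin_num (compact_borel cK) (compact_coord_bounded cK).
have vge0 n (A : set 'rV[R]_n) : 0 <= fine (vol A) by rewrite fine_ge0 ?vol_ge0.
rewrite -(fineK finS) -(fineK finP) -(fineK finK) -!EFinM lee_fin.
pose C := C1 + C2 + C3.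
have C0 : 0 <= C by rewrite /C !addr_ge0.
apply: (polynomial_growth_le C0 _ (N := d + k)) => [|m Cm];
  first by rewrite mulr_ge0.
have m0 : 0 < m%:R :> R by exact: le_lt_trans Cm.
have m0N : (0 < m)%N by rewrite -(ltr0n R).
have mn0 : m%:R != 0 :> R by rewrite gt_eqF.
have mC : 0 <= m%:R - C by rewrite subr_ge0 ltW.
have [c1 c2 c3] : [/\ C1 <= C, C2 <= C & C3 <= C] by rewrite /C; split; lra.
have hS := lS C m c1 Cm; have hP := lP C m c2 Cm.
have hK := uK C m c3 m0N.
have cmK : compact (dilate m%:R K) by exact: compact_dilate.
have := disc (dilate m%:R K) _ (proj2 (convex_setP _) (@convexR_dilate _ _ _
  m%:R vK))
  (compact_bounded cmK).
have mK0 : dilate m%:R K 0 by rewrite /dilate /= scaler0.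
move=> /(_ (ex_intro _ 0 mK0)).
have bmK := compact_coord_bounded cmK.
move=> hd; have {}hd := leq_trans (leq_mul (G_n_le_G_last bmK) (G_n_le_G_first
  bmK)) hd.
have ES : dilate m%:R S = [set c : 'rV[R]_k | dilate m%:R K (row_mx c 0)].
  by apply/funext => c; rewrite /dilate /S /= scale_row_mx scaler0.
have EP : dilate m%:R P = [set c : 'rV[R]_d | exists a, dilate m%:R K (row_mx a
  c)].
  apply/seteqP; split=> c [a Ka].
    exists (m%:R *: a); rewrite /dilate /= scale_row_mx scalerA mulVf// scale1r.
    exact: Ka.
  by exists (m%:R^-1 *: a); rewrite -scale_row_mx.
move: hd; rewrite -ES -EP -(ler_nat R) !natrM => hd.
rewrite exprD mulrACA; apply: le_trans (ler_pM _ _ hP hS) _.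
- by rewrite mulr_ge0// exprn_ge0.
- by rewrite mulr_ge0// exprn_ge0.
apply: le_trans hd _; rewrite mulrCA ler_wpM2l//.
by rewrite (addnC d).
Qed.

End CoordinateSubspace.

(** * Orthonormal bases and reduction to the coordinate subspace *)

Section OrthonormalBases.
Variable R : realType.

Lemma dotrV_gt0 n (x : 'rV[R]_n) : x != 0 -> 0 < dotrV x x.
Proof.
move=> /matrix0Pn[i [j]]; rewrite (ord1 i) => xj.
rewrite /dotrV (bigD1 j)//= ltr_wpDr//.
  by apply: sumr_ge0 => l _; rewrite -expr2 sqr_ge0.
by rewrite -expr2 lt0r sqr_ge0 sqrf_eq0 xj.
Qed.

Lemma gram_schmidt n r (A : 'M[R]_(r, n)) : row_free A ->
  exists2 B : 'M[R]_(r, n), B *m B^T = 1%:M & (B :=: A)%MS.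
Proof.
elim: r A => [|r IH] A fA.
  by exists A => //; rewrite [LHS]flatmx0 [RHS]flatmx0.
pose a : 'rV[R]_n := @usubmx _ 1 r n A; pose A' := @dsubmx _ 1 r n A.
have AE : A = col_mx a A' by rewrite vsubmxK.
have rA : (\rank (a + A')%MS = r.+1)%N by rewrite addsmxE -AE; exact/eqP.
have fA' : row_free A'.
  rewrite /row_free eqn_leq rank_leq_row /=.
  have := (mxrank_adds_leqif a A').1; rewrite rA => h.
  by have := leq_trans h (leq_add (rank_leq_row a) (leqnn _));
    rewrite add1n ltnS.
have aA' : ~~ (a <= A')%MS.
  apply/negP => s; have : (\rank (a + A')%MS <= r)%N.
    by apply: leq_trans (rank_leq_row A'); apply: mxrankS;
      rewrite addsmx_sub s submx_refl.
  by rewrite rA ltnn.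
have [B BB BA] := IH A' fA'.
(* As B B^T = 1, [a *m B^T *m B] is the orthogonal projection of [a] onto the row space of [B]; [b]
   is nonzero since [a] is not in that space. *)
pose b := a - a *m B^T *m B.
have bB : b *m B^T = 0 by rewrite mulmxBl -[X in _ - X]mulmxA BB mulmx1 subrr.
have b0 : b != 0.
  apply: contraNneq aA' => /eqP; rewrite subr_eq0 => /eqP ->.
  by rewrite -BA submxMl.
have nb := dotrV_gt0 b0.
pose c := (Num.sqrt (dotrV b b))^-1.
have c0 : c != 0 by rewrite invr_eq0 sqrtr_eq0 -ltNge.
have bb : b *m b^T = (dotrV b b)%:M.
  by apply/matrixP => i j; rewrite !ord1 -dotrV_mulmx mxE eqxx mulr1n.
have orthB : col_mx (c *: b) B *m (col_mx (c *: b) B)^T = 1%:M :> 'M[R]_(1 + r).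
  rewrite tr_col_mx mul_col_row linearZ /= -!scalemxAl -!scalemxAr bb bB BB
    scaler0.
  have -> : B *m b^T = 0 by apply: trmx_inj; rewrite trmx_mul trmxK trmx0.
  rewrite scaler0 !scale_scalar_mx mulrA -expr2 /c exprVn sqr_sqrtr ?ltW//.
  by rewrite mulVf ?gt_eqF// -scalar_mx_block.
exists (col_mx (c *: b) B); first exact: orthB.
rewrite AE; suff : (col_mx (c *: b) B :=: col_mx a A')%MS by [].
apply/eqmxP; rewrite -!addsmxE.
apply/andP; split; rewrite addsmx_sub; apply/andP; split.
- apply: scalemx_sub; rewrite addmx_sub ?addsmxSl// -mulNmx.
  by apply: submx_trans (submxMl _ _) _; rewrite BA addsmxSr.
- by rewrite BA addsmxSr.
- rewrite -[a](subrK (a *m B^T *m B)) addmx_sub//.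
    have -> : a - a *m B^T *m B = c^-1 *: (c *: b) by rewrite scalerA mulVf//
      scale1r.
    by apply: scalemx_sub; exact: addsmxSl.
  by apply: mulmx_sub; exact: addsmxSr.
- by rewrite -BA addsmxSr.
Qed.

Lemma orthonormal_basisP n j (E : set 'rV[R]_n) (B : 'M[R]_(j, n)) :
  orthonormal_basis E B <-> B *m B^T = 1%:M /\ E = [set x | (x <= B)%MS].
Proof.
have h i i' : dotrV (row i B) (row i' B) = (B *m B^T) i i'.
  by rewrite /dotrV mxE; apply: eq_bigr => l _; rewrite !mxE.
split=> -[hB ->]; split => //.
  by apply/matrixP => i i'; rewrite -h hB mxE.
by move=> i i'; rewrite h hB mxE.
Qed.

Lemma orthonormal_basis_row_space n m r (M : 'M[R]_(m, n)) : \rank M = r ->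
  exists B : 'M[R]_(r, n), orthonormal_basis [set x | (x <= M)%MS] B.
Proof.
move=> rM; subst r; have [B BB BM] := gram_schmidt (row_base_free M).
exists B; apply/orthonormal_basisP; split=> //; apply/funext => x /=.
by rewrite BM eq_row_base.
Qed.

Lemma vspace_row_space n (V : {vspace 'rV[R]_n}) :
  exists2 M : 'M[R]_(\dim V, n), \rank M = \dim V & [set` V] = [set x | (x <=
    M)%MS].
Proof.
pose M : 'M[R]_(\dim V, n) := \matrix_i (vbasis V)`_i.
have DM (D : 'rV[R]_(\dim V)) : D *m M = \sum_i D 0 i *: (vbasis V)`_i.
  by rewrite mulmx_sum_row; apply: eq_bigr => i _; rewrite rowK.
exists M.
  apply/eqP; rewrite -/(row_free M); apply: inj_row_free => D; rewrite DM => D0.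
  apply/rowP => i; rewrite mxE; move: D0.
  by have /freeP fV := basis_free (vbasisP V); move=> /fV ->.
apply/seteqP; split=> x /=.
  move=> xV; apply/submxP; exists (\row_i coord (vbasis V) i x).
  rewrite DM {1}(coord_vbasis xV); apply: eq_bigr => i _; by rewrite mxE.
move=> /submxP[D ->]; rewrite DM; apply: memv_suml => i _.
by apply/memvZ/vbasis_mem/mem_nth; rewrite size_tuple.
Qed.

Lemma orth_row_space n r (B : 'M[R]_(r, n)) :
  orth [set x | (x <= B)%MS] = [set x | x *m B^T = 0].
Proof.
apply/seteqP; split=> x /=.
  move=> h; apply/rowP => i; rewrite [RHS]mxE -[RHS](h (row i B) (row_sub i B)).
  by rewrite /dotrV mxE; apply: eq_bigr => l _; rewrite !mxE.
by move=> xB y /submxP[D ->]; rewrite dotrV_mulmx trmx_mul mulmxA xB mul0mx mxE.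
Qed.

(** It is enough to test the functional at p and at p + rho e_i. *)
Lemma contains_box_hyperplane n (A : set 'rV[R]_n) p rho (u : 'cV[R]_n) :
  0 < rho -> contains_box A p rho -> (forall x, A x -> x *m u = 0) -> u = 0.
Proof.
move=> rho0 Ap Au; apply/matrixP => i j.
have Ap0 : A p by apply: Ap => l; rewrite subrr normr0 ltW.
have Ai : A (p + rho *: delta_mx 0 i).
  apply: Ap => l; rewrite !mxE addrAC subrr add0r normrM gtr0_norm//.
  by rewrite ger_pMr// eqxx /=; case: (l == i); rewrite ?normr0 ?normr1.
have /matrixP/(_ 0 j) := Au _ Ai;
  rewrite mulmxDl Au// add0r -scalemxAl -rowE !mxE.
by move=> /eqP; rewrite mulf_eq0 gt_eqF//= => /eqP.
Qed.

(** The dimension is given by the equation n = k + d, so that after substitution vectors split into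
    blocks of sizes k and d without casts. *)
Lemma projection_section_of_discrete n k d (K : set 'rV[R]_n)
    (H : {vspace 'rV[R]_n}) :
  n = (k + d)%N -> compact K -> convex_set K -> K 0 -> has_dim K n ->
  let H0 := [set` coord_subspace R n k] in
  (forall M : set 'rV[R]_n, M !=set0 -> convex_set M -> bounded_set M ->
     (G_last k (oproj (orth H0) M) * G_first k (M `&` H0)
      <= 'C(n, k) * G_n (minkowski_sum M (open_cube n 1)))%N) ->
  \dim H = k ->
  (vol_on d (orth [set` H]) (oproj (orth [set` H]) K)
     * vol_on k [set` H] (K `&` [set` H])
   <= ('C(n, k))%:R%:E * vol K)%E.
Proof.
move=> nE; subst n => cK /convex_setP vK K0 dK H0 disc dH.
have [p [rho rho0 Kp]] := full_dim_box vK K0 dK.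
have [M rM HM] := vspace_row_space H.
have exB : exists B : 'M[R]_(k, (k + d)%N), orthonormal_basis [set` H] B.
  by rewrite HM; apply: orthonormal_basis_row_space; rewrite rM.
rewrite /vol_on.
(* [get] would return a default value if no basis existed; [exB] ensures that it satisfies the
   predicate. *)
set B := get [set B : 'M[R]_(k, (k + d)%N) | orthonormal_basis [set` H] B].
have /orthonormal_basisP[BB HB] : orthonormal_basis [set` H] B := getPex exB.
have exB' : exists B' : 'M[R]_(d, (k + d)%N), orthonormal_basis (orth [set` H])
  B'.
  have -> : orth [set` H] = [set x | (x <= kermx B^T)%MS].
    rewrite HB orth_row_space; apply/funext => x /=; rewrite propeqE.
    by split=> [xB|/sub_kermxP//]; apply/sub_kermxP.
  apply: orthonormal_basis_row_space; rewrite mxrank_ker mxrank_tr.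
  have fB : row_free B by apply/row_freeP; exists B^T.
  by rewrite (eqP fB) addKn.
set B' := get [set B : 'M[R]_(d, (k + d)%N) | orthonormal_basis (orth [set` H])
  B].
have /orthonormal_basisP[BB' HB'] : orthonormal_basis (orth [set` H]) B' :=
  getPex exB'.
(* x |-> xO carries the coordinate subspace to H and its complement to the complement of H, so K is
   replaced by the rotated body {x | xO in K}. *)
pose O : 'M[R]_(k + d) := col_mx B B'.
have B'B : B' *m B^T = 0.
  apply/row_matrixP => i; rewrite row0 row_mul.
  have : orth [set` H] (row i B') by rewrite HB' /= row_sub.
  by rewrite HB orth_row_space.
have BB'0 : B *m B'^T = 0 by apply: trmx_inj; rewrite trmx_mul trmxK trmx0.
have OO : O *m O^T = 1%:M.
  by rewrite /O tr_col_mx mul_col_row BB BB' B'B BB'0 -scalar_mx_block.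
have OO' : O^T *m O = 1%:M by exact: mulmx1C.
have cmK : compact [set x | K (x *m O)].
  have := compact_mulmx (O := O^T) cK; congr compact; apply/seteqP;
    split=> [_ [x Kx <-]|x Kx].
    by rewrite /= -mulmxA OO' mulmx1.
  by exists (x *m O) => //; rewrite -mulmxA OO mulmx1.
have vmK : convexR [set x | K (x *m O)] by exact: convexR_mulmx.
(* A functional [u] vanishing on the rotated body would make O^T u vanish on K, which contains a
   box. *)
have [q [r r0 Kq]] : exists q, exists2 r, 0 < r & contains_box [set x | K (x *m
  O)] q r.
  have [[W uW KW]|[u u0 Ku]] := spanning_or_hyperplane (A := [set x | K (x *m
    O)]) ltac:(by rewrite /= mul0mx).
    by apply: (contains_box_of_basis vmK _ uW KW); rewrite /= mul0mx.
  case/eqP: u0; have Ou : O^T *m u = 0.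
    apply: (contains_box_hyperplane rho0 Kp) => x Kx; rewrite mulmxA; apply: Ku.
    by rewrite /= -mulmxA OO' mulmx1.
  by rewrite -[u]mul1mx -OO -mulmxA Ou mulmx0.
rewrite -(vol_orthogonal OO vK (compact_borel cK) (compact_coord_bounded cK)
  rho0 Kp).
have := projection_section_coord cmK vmK _ r0 Kq disc.
rewrite /= mul0mx => /(_ K0); congr (_ * _ <= _)%E.
- congr vol; apply/seteqP; split=> c /=.
    move=> [a]; rewrite mul_row_col => Ka.
    split; first by rewrite HB' /= submxMl.
    exists (a *m B + c *m B') => //; rewrite addrK => y.
    rewrite HB orth_row_space /= => yB.
    rewrite dotrV_mulmx -mulmxA; have -> : B *m y^T = 0.
      by apply: trmx_inj; rewrite trmx_mul trmxK trmx0.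
    by rewrite mulmx0 mxE.
  move=> [_ [x Kx xc]].
  (* x O^T lists the coordinates of x in the basis O: the leading block is the free witness, and the
     trailing block is c because x - cB' is orthogonal to the rows of B'. *)
  exists (lsubmx (x *m O^T)).
  suff -> : c = rsubmx (x *m O^T) by rewrite hsubmxK -mulmxA OO' mulmx1.
  rewrite HB' orth_row_space /= mulmxBl -mulmxA BB' mulmx1 in xc.
  by rewrite /O tr_col_mx mul_mx_row row_mxKr; apply/esym/eqP;
    rewrite -subr_eq0 xc.
- congr vol; apply/seteqP; split=> c /=; rewrite mul_row_col mul0mx addr0.
    by move=> Kc; split=> //; have : [set` H] (c *m B) by rewrite HB /= submxMl.
  by case.
Qed.

End OrthonormalBases.

Theorem theorem3p5 (R : realType) (n : nat) (K L : set 'rV[R]_n)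
    (n_ge1 : (1 <= n)%N)
    (K_compact : compact K) (K_convex : convex_set K) (K0 : K 0)
    (K_dim : has_dim K n)
    (L_compact : compact L) (L_convex : convex_set L) (L0 : L 0)
    (L_dim : has_dim L n) :
  (forall k : nat, (2 <= n)%N -> (1 <= k <= n - 1)%N ->
     let H0 := [set` coord_subspace R n k] in
     (forall M : set 'rV[R]_n, M !=set0 -> convex_set M -> bounded_set M ->
        (G_last k (oproj (orth H0) M) * G_first k (M `&` H0)
         <= 'C(n, k) * G_n (minkowski_sum M (open_cube n 1)))%N) ->
     forall H : {vspace 'rV[R]_n}, \dim H = k ->
       (vol_on (n - k) (orth [set` H]) (oproj (orth [set` H]) K)
          * vol_on k [set` H] (K `&` [set` H])
        <= ('C(n, k))%:R%:E * vol K)%E)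
  /\
  ((forall M N : set 'rV[R]_n,
      convex_set M -> bounded_set M -> M 0 ->
      convex_set N -> bounded_set N -> N 0 ->
      (G_n (minkowski_sum M N) * G_n (M `&` oppset N)
       <= 'C(2 * n, n) * G_n (minkowski_sum M (open_cube n 1))
            * G_n (minkowski_sum N (open_cube n 2)))%N) ->
   (vol (minkowski_sum K L) * vol (K `&` oppset L)
    <= ('C(2 * n, n))%:R%:E * vol K * vol L)%E).
Proof.
split; last exact: rogers_shephard_of_discrete.
move=> k _ /andP[k1 kn] H0 disc H dH.
apply: projection_section_of_discrete => //.
by rewrite subnKC// (leq_trans kn)// leq_subr.
Qed.
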